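(* For every integer $d \ge 1$ there exists a surjective $\mathbb{Z}^d$-cellular automaton $(S^{\mathbb{Z}^d},T)$ with positive, finite topological entropy, i.e. $0<h_{\mathrm{top}}(S^{\mathbb{Z}^d},T)<\infty$.
   Context: Let $S$ be a finite set. The space $S^{\mathbb{Z}^d}$ carries the product topology (of the discrete topology on $S$), and $\mathbb{Z}^d$ acts on it by translations $(\sigma_m x)_n = x_{n+m}$. A $\mathbb{Z}^d$-cellular automaton (CA) is a pair $(S^{\mathbb{Z}^d},T)$ where $S$ is a finite set and $T:S^{\mathbb{Z}^d}\to S^{\mathbb{Z}^d}$ is a continuous map commuting with all the translations $\sigma_m$, $m \in \mathbb{Z}^d$ (the cellular automaton is always defined on the whole full shift $S^{\mathbb{Z}^d}$). It is surjective if $T$ is surjective. For a finite set $F\subset\mathbb{Z}^d$ and $n \ge 1$ let $$W(F,n,T)=\left\{\left(x_F,(Tx)_F,\ldots,(T^{n-1}x)_F\right) : x\in S^{\mathbb{Z}^d}\right\},$$ where $x_F$ denotes the restriction of $x$ to $F$. The topological entropy is $$h_{\mathrm{top}}(S^{\mathbb{Z}^d},T)=\sup_{F}\lim_{n\to\infty}\frac1n\log|W(F,n,T)|,$$ the supremum being over all finite $F\subset\mathbb{Z}^d$. *)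

(* Defs.v *)
From mathcomp Require Import all_boot all_order all_algebra finmap.
From mathcomp Require Import all_classical all_reals all_analysis.

Set Implicit Arguments.
Unset Strict Implicit.
Unset Printing Implicit Defensive.

Import Order.TTheory GRing.Theory Num.Theory.
Import numFieldNormedType.Exports.

Local Open Scope ring_scope.

Section CellularAutomata.
Variables (d : nat) (S : finType).

(* Z^d is the additive group of integer row vectors; the full shift carries the
   product of the discrete topologies on S. *)
Definition full_shift := {ptws 'rV[int]_d -> discrete_topology S}.

Definition translation (m : 'rV[int]_d) (x : full_shift) : full_shift :=
  fun n => x (n + m).

Definition cellular_automaton (T : full_shift -> full_shift) : Prop :=
  continuous T /\ forall m x, T (translation m x) = translation m (T x).

Definition word (F : {fset 'rV[int]_d}) (n : nat)
    (T : full_shift -> full_shift) (x : full_shift) :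
    {ffun 'I_n -> {ffun F -> S}} :=
  [ffun i : 'I_n => [ffun p : F => iter i T x (val p)]].

Definition words (F : {fset 'rV[int]_d}) (n : nat)
    (T : full_shift -> full_shift) : {set {ffun 'I_n -> {ffun F -> S}}} :=
  [set w | `[< exists x, w = word F n T x >] ].

(* The limit exists for every T and F by Fekete's lemma, n |-> ln #|words F n T|
   being subadditive; the term n = 0 is irrelevant to it. *)
Definition topological_entropy (R : realType)
    (T : full_shift -> full_shift) : \bar R :=
  ereal_sup (range (fun F : {fset 'rV[int]_d} =>
    (limn (fun n : nat => ln (#|words F n T|%:R : R) / n%:R) : R)%:E)).

End CellularAutomata.

(* Main.v *)
Require Import Defs.
From mathcomp Require Import all_boot all_order all_algebra finmap.
From mathcomp Require Import all_classical all_reals all_analysis.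
From mathcomp Require Import zify ring lra.

Set Implicit Arguments.
Unset Strict Implicit.
Unset Printing Implicit Defensive.

Import Order.TTheory GRing.Theory Num.Theory.
Import numFieldNormedType.Exports.

(** The automaton is a second-order one. A configuration carries at each site z
    a label, which never changes, and for each q in a finite set Q two bits u, v.
    The labels determine, locally and equivariantly, a partial map [next] on
    Z^d * Q, and T replaces (u, v) at s by (v, u + v(next s)) modulo 2, the sum
    being u where [next] is undefined. From the image one reads off first v, then
    u, so T is onto whatever [next] is ([route_surj]); all the work goes into
    choosing [next] so that the entropy is positive and finite.

    The bits seen at s up to time n are a function of the bits carried by the
    forward orbit s, next s, next (next s), and so on. Hence an infinite orbit
    without repetition gives 2^n words in a window of one cell ([words_lower]).
    In the other direction, suppose that long orbits are crowded: for arbitrarily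
    large N, an orbit that is defined for long enough visits N^d cells within
    distance K N of its start, with K fixed ([covering]). Of the long orbits that
    start in a window of radius less than N, choose a maximal family of pairwise
    disjoint ones. Their visited states are distinct and lie in a box of
    (2K+3)^d N^d cells, so the family has at most M = (2K+3)^d |Q| members, a
    bound that does not depend on the window. Every other orbit stops soon or soon
    merges with one of the family, so up to a factor constant in n the bits along
    at most M orbits decide everything, and the number of words grows at most
    like 5^((M+1)n) ([words_upper]; five because a symbol is a pair of bits or
    nothing). Crowding also forbids periodic orbits, so one infinite orbit is
    enough for positivity ([route_entropy]).

    For d = 1 the shift s |-> s + 1 is crowded. For d >= 2 the orbits must follow
    a space-filling curve, and the labels are arbitrary: the curve has to be
    enforced by local rules that are tested only on the cells visited, the map
    being undefined where a test fails. The curve is Peano's in base 3. Boxes of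
    level m + 1 are rows of three boxes of level m in direction m mod d, each
    traversed from one corner to the opposite one; crossing a wall in direction D
    reverses the heading in all other directions. Every cell and every unit face
    carries a certificate: the position of a box among its siblings and some data
    about the walls of that box. A cell certifies itself, a face certifies the box
    that it cuts as an internal wall. Adjacent certificates must be compatible,
    and where two walls cross, the lower one must end at the higher one.

    The heart of the proof ([next_traversal_all]) is an induction on the level:
    the boxes traversed obey among themselves the same rules as the unit cells,
    with the certificates of their walls in the role of the cell certificates. So
    a path that runs long enough traverses complete boxes of every level, after a
    drift that is bounded by a multiple of the side ([start_traversal],
    [drift_mul]), which is crowding ([peano_cover]). The balanced ternary
    expansion gives labels that satisfy the rules everywhere, hence an infinite
    orbit ([run_model]). *)

Local Open Scope classical_set_scope.
Local Open Scope ring_scope.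

(** * Orbits of partial maps *)
Section Iterates.
Variables (X : Type) (f : X -> option X).
Definition run (s : X) (n : nat) : option X := iter n (obind f) (Some s).

Lemma runD s m n s' : run s m = Some s' -> run s (m + n) = run s' n.
Proof. by move=> h; rewrite /run addnC iterD -/(run s m) h. Qed.

Lemma runS s n : run s n.+1 = obind f (run s n). Proof. by []. Qed.

Lemma run_le s m n : (m <= n)%N -> isSome (run s n) -> isSome (run s m).
Proof.
move=> /subnKC <-; elim: (n - m)%N => [|j IH]; first by rewrite addn0.
by rewrite addnS runS; case E: (run s (m + j)) IH => [y|//] IH _; apply: IH.
Qed.

Lemma run_some s m n : (m <= n)%N -> isSome (run s n) ->
  exists s', run s m = Some s'.
Proof. by move=> mn /(run_le mn); case: (run s m) => // s' _; exists s'. Qed.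

End Iterates.

(** * Continuity of locally determined maps *)
Lemma continuous_prod_topology (X : topologicalType) (I : eqType)
    (K : I -> topologicalType) (f : X -> prod_topology K) :
  (forall i, continuous (fun x => f x i)) -> continuous f.
Proof.
move=> cf x; apply/cvg_sup => i.
by have := @continuous_comp_initial _ _ _ (@proj I K i) f (cf i) x.
Qed.

(** The set of sites that determines an output may depend on the configuration:
    continuity in the product topology is a statement at each point. *)
Lemma local_continuous d (S : finType) (T : full_shift d S -> full_shift d S) :
  (forall (x : full_shift d S) z, exists B : seq 'rV[int]_d,
     forall y : full_shift d S, (forall w, w \in B -> y w = x w) -> T y z = T x z) ->
  continuous T.
Proof.
move=> loc.
apply: (@continuous_prod_topology _ _ (fun=> discrete_topology S)) => z x.
have [B hB] := loc x z.
pose X := prod_topology (fun _ : 'rV[int]_d => discrete_topology S).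
have FF : Filter (nbhs (x : X)) by exact: nbhs_filter.
have nB : nbhs (x : X) [set y : X | forall w, w \in B -> y w = x w].
  elim: B {hB} => [|b B IH].
    by have -> : [set y : X | forall w, w \in [::] -> y w = x w] = setT;
       [rewrite predeqE | exact: filterT].
  have hb : nbhs (x : X) [set y : X | y b = x b].
    have h := @proj_continuous _ (fun=> discrete_topology S) b x.
    apply: (h [set u | u = x b]).
    rewrite nbhs_principalE; apply/principal_filterP. by [].
  apply: filterS (filterI hb IH) => y /= [yb yB] w.
  by rewrite inE => /orP[/eqP->//|]; exact: yB.
move=> U QTx; apply: filterS nB => y yB /=.
rewrite (hB _ yB); exact: nbhs_singleton QTx.
Qed.

(** * The second-order automaton of a partial map *)
Section Routed.
Variables (d : nat) (A Q : finType).
Local Notation pos := 'rV[int]_d.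
Local Notation state := (pos * Q)%type.
Variable nxt : (pos -> A) -> state -> option state.

Definition alphabet : finType := (A * {ffun Q -> bool * bool})%type.
Local Notation shift := (full_shift d alphabet).

Definition labels (x : shift) : pos -> A := fun z => (x z : alphabet).1.
Definition bits (x : shift) (s : state) : bool * bool := (x s.1 : alphabet).2 s.2.

(** The shear by the bits of the next state is an involution up to the exchange
    of the two bits, whence surjectivity for every routing map. *)
Definition route (x : shift) : shift := fun z =>
  (labels x z, [ffun q => ((bits x (z, q)).2,
     (bits x (z, q)).1 (+) (if nxt (labels x) (z, q) is Some s then (bits x s).2 else false))]).

Lemma labels_route x : labels (route x) = labels x. Proof. by []. Qed.

Lemma bits_route x s : bits (route x) s = ((bits x s).2,
   (bits x s).1 (+) (if nxt (labels x) s is Some s' then (bits x s').2 else false)).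
Proof. by case: s => z q; rewrite {1}/bits /= ffunE. Qed.

Lemma shift_eq (x y : shift) : labels x = labels y -> (forall s, bits x s = bits y s) -> x = y.
Proof.
move=> hl hm; apply/funext => z.
rewrite [LHS]surjective_pairing [RHS]surjective_pairing; congr (_, _).
  by have := congr1 (@^~ z) hl.
by apply/ffunP => q; exact: (hm (z, q)).
Qed.

(** The second bits of the preimage are the first bits of the image, and they
    determine what was added to the first bits. *)
Lemma route_surj : set_surj setT setT route.
Proof.
move=> y _; pose g s := (bits y s).1.
exists (fun z => (labels y z, [ffun q => ((bits y (z, q)).2 (+)
   (if nxt (labels y) (z, q) is Some s then g s else false), g (z, q))])) => //.
set x := (X in route X).
have hm s : bits x s = ((bits y s).2 (+)
   (if nxt (labels y) s is Some s' then g s' else false), g s).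
  by case: s => z q; rewrite {1}/bits /= ffunE.
apply: shift_eq => // s; rewrite bits_route hm /=.
have -> : labels x = labels y by [].
rewrite -addbA; case: (nxt _ _) => [s'|]; rewrite ?hm /= ?addbb ?addbF;
  by rewrite /g -surjective_pairing.
Qed.

Hypothesis nxt_equi : forall a m z q,
  nxt (fun n => a (n + m)) (z, q) =
  omap (fun s => (s.1 - m, s.2)) (nxt a (z + m, q)).
Hypothesis nxt_local : forall z q, exists B : seq pos, forall a a',
  (forall w, w \in B -> a w = a' w) -> nxt a (z, q) = nxt a' (z, q).

Lemma route_equi m x : route (translation m x) = translation m (route x).
Proof.
apply: shift_eq => // -[z q].
have tr (y : shift) s : bits (translation m y) s = bits y (s.1 + m, s.2) by [].
rewrite bits_route !tr bits_route /=; congr (_, _ (+) _).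
have -> : labels (translation m x) = (fun n => labels x (n + m)) by [].
rewrite nxt_equi; case: (nxt _ _) => //= s'.
by rewrite tr /= subrK -surjective_pairing.
Qed.

Lemma route_continuous : continuous route.
Proof.
apply: local_continuous => x z.
have [B hB] : exists B : seq pos, forall q a a',
    (forall w, w \in B -> a w = a' w) -> nxt a (z, q) = nxt a' (z, q).
  have [Bq hBq] := choice (nxt_local z).
  exists (flatten [seq Bq q | q <- enum Q]) => q a a' h; apply: hBq => w wB.
  by apply: h; apply/flatten_mapP; exists q => //; rewrite mem_enum.
exists (z :: B ++ [seq (if nxt (labels x) (z, q) is Some s then s.1 else z) | q <- enum Q]).
move=> y hy.
have yz : y z = x z by apply: hy; rewrite mem_head.
have ny q : nxt (labels y) (z, q) = nxt (labels x) (z, q).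
  by apply: hB => w wB; rewrite /labels hy // inE mem_cat wB orbT.
rewrite /route; congr (_, _); first by rewrite /labels yz.
apply/ffunP => q; rewrite !ffunE {1 3}/bits /= yz ny; congr (_, _ (+) _).
  by rewrite /bits /= yz.
case E : (nxt _ _) => [s|//]; rewrite /bits hy // inE mem_cat.
apply/orP; right; apply/orP; right; apply/mapP; exists q; first by rewrite mem_enum.
by rewrite E.
Qed.

Lemma route_ca : cellular_automaton route.
Proof. by split; [exact: route_continuous|exact: route_equi]. Qed.

Local Notation path x := (run (nxt (labels x))).
(** The bits met along the orbit; the value None records that the orbit has
    stopped, so that a trace determines the trace of the image. *)
Definition trace (x : shift) (s : state) (i : nat) : option (bool * bool) :=
  omap (bits x) (path x s i).

Lemma trace_route x s i : trace (route x) s i =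
  omap (fun p => (p.2, p.1 (+) (if trace x s i.+1 is Some p' then p'.2 else false)))
       (trace x s i).
Proof.
rewrite /trace labels_route runS; case: (run _ s i) => //= s'.
by rewrite bits_route; case: (nxt _ s').
Qed.

(** Merging orbits have equal traces after the merger, whatever their starting
    states; this is why two configurations and two states occur here. *)
Lemma trace_bits n x y s s' : (forall i, (i <= n)%N -> trace x s i = trace y s' i) ->
  bits (iter n route x) s = bits (iter n route y) s'.
Proof.
elim: n x y => [|n IH] x y h; first by case: (h 0%N isT).
rewrite !iterSr; apply: IH => i le.
by rewrite !trace_route (h i (leqW le)) (h i.+1 le).
Qed.

(** The second bit at time t is the second bit carried t steps ahead plus a
    function of the bits before it: a history reveals the orbit bit by bit. *)
Lemma trace_lead t x y s sx sy : path x s t = Some sx -> path y s t = Some sy ->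
  (forall i, (i < t)%N -> trace x s i = trace y s i) ->
  (bits (iter t route x) s).2 (+) (bits x sx).2 =
  (bits (iter t route y) s).2 (+) (bits y sy).2.
Proof.
elim: t x y sx sy => [|t IH] x y sx sy.
  by rewrite /run /= => -[<-] [<-]; rewrite !addbb.
rewrite !iterSr !runS; case Ex: (run (nxt (labels x)) s t) => [s1|//] /= nx.
case Ey: (run (nxt (labels y)) s t) => [s2|//] /= ny h.
have := IH (route x) (route y) s1 s2; rewrite !labels_route => /(_ Ex Ey).
rewrite !bits_route nx ny /= => H.
have : trace x s t = trace y s t by apply: h.
rewrite /trace Ex Ey /= => -[e]; move: H; rewrite e.
move: (bits y s2).1 => b H.
have {}H := H _; rewrite ![b (+) _]addbC ![_ (+) (_ (+) b)]addbA in H.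
apply: (can_inj (addbK b)); apply: H => i it.
by rewrite !trace_route (h i (ltnW it)) (h i.+1 it).
Qed.

Lemma labels_iter n x : labels (iter n route x) = labels x.
Proof. by elim: n => //= n IH; rewrite labels_route. Qed.

Lemma word_eq F n x y : (forall p, p \in F -> labels x p = labels y p) ->
  (forall p q t, p \in F -> (t < n)%N -> trace x (p, q) t = trace y (p, q) t) ->
  word F n route x = word F n route y.
Proof.
move=> hl ht; apply/ffunP => i; rewrite !ffunE; apply/ffunP => p; rewrite !ffunE.
have pF := valP p.
rewrite [LHS]surjective_pairing [RHS]surjective_pairing; congr (_, _).
  have := hl _ pF; rewrite -(labels_iter i x) -(labels_iter i y); exact.
apply/ffunP => q; apply: (trace_bits (s := (val p, q)) (s' := (val p, q))) => t ti.
by apply: ht => //; exact: leq_ltn_trans ti (ltn_ord i).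
Qed.

(** N and T depend on the required size r only: the bound must be uniform in the
    labels and in the starting state. *)
Definition covering K := forall r, exists N T, (r <= N)%N /\
  forall (a : pos -> A) (s : state), isSome (run (nxt a) s T) ->
  exists f : {ffun 'I_d -> 'I_N} -> pos, injective f /\
  forall k, (forall l, `|f k ord0 l - s.1 ord0 l| <= (K * N)%:Z) /\
    exists i q', (i <= T)%N /\ run (nxt a) s i = Some (f k, q').

(** * Upper bound on the number of words *)
Section Upper.
Variable K : nat.
Hypothesis cov : covering K.
Let M := ((2 * K + 3) ^ d * #|Q|)%N.

Section Window.
Variable F : {fset pos}.
Variables (N T r : nat).
Hypothesis Fr : forall p l, p \in F -> `|p ord0 l| <= r%:Z.
Hypothesis rN : (r < N)%N.
Hypothesis covNT : forall (a : pos -> A) (s : state), isSome (run (nxt a) s T) ->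
  exists f : {ffun 'I_d -> 'I_N} -> pos, injective f /\
  forall k, (forall l, `|f k ord0 l - s.1 ord0 l| <= (K * N)%:Z) /\
    exists i q', (i <= T)%N /\ run (nxt a) s i = Some (f k, q').

Local Notation P := (F * Q)%type.
Definition window_state (p : P) : state := (val p.1, p.2).

Section OneConf.
Variable a : pos -> A.
Let o p i := run (nxt a) (window_state p) i.
(** T is a length from which the covering property applies. *)
Definition long (p : P) := isSome (o p T).
(** A common state, possibly at different times: the two orbits then coincide up
    to a shift of time. *)
Definition meets (p p' : P) := [exists i : 'I_T.+1, exists j : 'I_T.+1,
  (o p i == o p' j) && isSome (o p i)].

Definition indep (D : {set P}) :=
  [forall p in D, long p] && [forall p in D, forall p' in D, (p != p') ==> ~~ meets p p'].

(** Each orbit of the family visits N^d cells of the cube of radius K N + r about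
    the origin, r < N, and no state is visited by two of them. Since the cube has
    at most ((2K+3) N)^d cells, the powers of N cancel. *)
Lemma indep_card D : indep D -> (#|D| <= M)%N.
Proof.
move=> /andP[/forall_inP lD /forall_inP iD].
have N0 : (0 < N)%N by exact: leq_ltn_trans rN.
(* B is the side of the cube; its cells are indexed after translation by
   K N + r, which makes the coordinates natural numbers. *)
pose B := (2 * (K * N + r)).+1.
have ex (p : P) : exists g : {ffun 'I_d -> 'I_N} -> {ffun 'I_d -> 'I_B} * Q, p \in D ->
   injective g /\ forall k, exists i, (i <= T)%N /\ 
     o p i = Some (\row_l ((g k).1 l : nat)%:Z - const_mx (K * N + r)%:Z, (g k).2).
  case pD : (p \in D); last by exists (fun=> ([ffun=> ord0], p.2)).
  have [f [fi hf]] := covNT (lD p pD).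
  have hq k : exists q', exists i, (i <= T)%N /\ o p i = Some (f k, q').
    by have [_ [i [q' [iT oi]]]] := hf k; exists q', i.
  have [gq hgq] := choice hq.
  have small k l : (absz (f k ord0 l + (K * N + r)%:Z)%R < B)%N /\
      (absz (f k ord0 l + (K * N + r)%:Z))%:Z = f k ord0 l + (K * N + r)%:Z.
    have [/(_ l) h _] := hf k; have := Fr l (valP p.1); rewrite /B.
    move: h; rewrite /window_state /=; move: (val p.1 ord0 l) (f k ord0 l) (K * N)%N => y x z.
    lia.
  exists (fun k => ([ffun l => Ordinal (small k l).1], gq k)) => _; split.
    move=> k k' [/ffunP e _]; apply: fi; apply/rowP => l.
    have := e l; rewrite !ffunE => /(congr1 val) /= e'.
    by apply: (addIr (K * N + r)%:Z); rewrite -(small k l).2 -(small k' l).2 e'.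
  move=> k; have [i [iT oi]] := hgq k; exists i; split=> //; rewrite oi /=.
  congr (Some (_, _)); apply/rowP => l; rewrite !mxE ffunE /= (small k l).2.
  by rewrite addrK.
have [g hg] := choice ex.
pose h (pk : P * {ffun 'I_d -> 'I_N}) : {ffun 'I_d -> 'I_B} * Q := g pk.1 pk.2.
have hinj : {in [predX mem D & predT] &, injective h}.
  move=> [p k] [p' k']; rewrite !inE /h /= !andbT => pD pD' e.
  case: (eqVneq p p') => [pp|pp].
    by subst p'; congr (_, _); have [gi _] := hg p pD; apply: gi.
  have [_ /(_ k)[i [iT oi]]] := hg p pD; have [_ /(_ k')[j [jT oj]]] := hg p' pD'.
  have /forall_inP/(_ p' pD') := iD p pD; rewrite pp /= => /existsP[].
  exists (Ordinal (iT : (i < T.+1)%N)); apply/existsP.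
  by exists (Ordinal (jT : (j < T.+1)%N)); rewrite /= oi oj e eqxx.
have := leq_card_in _ _ hinj.
rewrite cardX card_prod !card_ffun !card_ord => le.
have BN : (B <= (2 * K + 3) * N)%N by rewrite /B; lia.
rewrite -(leq_pmul2r (_ : 0 < N ^ d)%N) ?expn_gt0 ?N0 //.
apply: leq_trans le _; rewrite /M mulnAC -expnMn leq_mul2r.
by rewrite (_ : (B ^ d <= _)%N) ?orbT //; case: (d) => // e; rewrite leq_exp2r.
Qed.

Lemma meets_refl p : long p -> meets p p.
Proof.
move=> lp; apply/existsP; exists ord0; apply/existsP; exists ord0.
by rewrite eqxx.
Qed.

Lemma meets_sym p p' : meets p p' -> meets p' p.
Proof.
move=> /existsP[i /existsP[j /andP[/eqP e h]]].
apply/existsP; exists j; apply/existsP; exists i; rewrite e eqxx /=.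
by rewrite -e.
Qed.

Lemma indep_max : exists D : {set P}, indep D /\
  forall p, long p -> exists2 p', p' \in D & meets p p'.
Proof.
have i0 : indep finset.set0.
  by apply/andP; split; apply/forall_inP => p; rewrite finset.in_set0.
case: (arg_maxnP (fun D : {set P} => #|D|) i0) => D iD maxD; exists D; split=> // p lp.
apply: contrapT => no.
have none p' : p' \in D -> ~~ meets p p'.
  by move=> h; apply/negP => hm; apply: no; exists p'.
have pD : p \notin D.
  by apply/negP => /none; rewrite (meets_refl lp).
have : indep (p |: D)%SET.
  move/andP: (iD) => [/forall_inP l1 /forall_inP l2].
  apply/andP; split; apply/forall_inP => p1; rewrite !finset.inE.
    by case/orP => [/eqP->|/l1].
  move=> h1; apply/forall_inP => p2; rewrite !finset.inE => h2.
  apply/implyP => ne; case/orP: h1 => [/eqP e1|h1]; case/orP: h2 => [/eqP e2|h2].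
  - by rewrite e1 e2 eqxx in ne.
  - by rewrite e1; exact: none.
  - by apply/negP => /meets_sym; rewrite e2 => h; move: (none _ h1); rewrite h.
  - by have /forall_inP/(_ _ h2) := l2 _ h1; rewrite ne.
move=> /maxD /=; by rewrite cardsU1 pD add1n ltnn.
Qed.

End OneConf.

Variable n : nat.
Local Notation bb := (option (bool * bool)).
(** What determines a word: the labels on the window, the first T + 1 symbols of
    each trace, for each long orbit the member of the family that it meets and the
    two times of meeting, and the traces of that family up to time n + T. Only the
    last part grows with n, and it has room for M + 1 traces. *)
Definition code : finType := ({ffun F -> A} * {ffun P -> {ffun 'I_T.+1 -> bb}} *
  {ffun P -> option ('I_M.+1 * 'I_T.+1 * 'I_T.+1)} * {ffun 'I_M.+1 * 'I_(n + T) -> bb})%type.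

Definition look (c : {ffun 'I_M.+1 * 'I_(n + T) -> bb}) (m : 'I_M.+1) (t : nat) : bb :=
  if insub t is Some t' then c (m, t') else None.

Definition decode (c : code) (p : P) (t : nat) : bb :=
  if insub t is Some t' then c.1.1.2 p t'
  else if c.1.2 p is Some (m, i, j) then look c.2 m (t - i + j) else None.

(** Beyond time T a trace is that of a member of the maximal family from the
    meeting point on, unless the orbit has already stopped; then no member is
    recorded and the decoded symbol is None as well. *)
Lemma encode (x : shift) : exists c : code,
  (forall p : F, c.1.1.1 p = labels x (val p)) /\
  (forall p t, (t < n)%N -> trace x (window_state p) t = decode c p t).
Proof.
have [D [iD hD]] := indep_max (labels x).
have cD := indep_card iD.
pose e := [seq Some p | p <- enum D].
pose tr p (t : nat) := trace x (window_state p) t.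
have hm p : exists k : option ('I_M.+1 * 'I_T.+1 * 'I_T.+1),
   if long (labels x) p then
     exists m i j p', [/\ k = Some (m, i, j), nth None e m = Some p' &
        path x (window_state p) i = path x (window_state p') j]
   else k = None.
  case lp : (long (labels x) p); last by exists None.
  have [p' p'D /existsP[i /existsP[j /andP[/eqP ee _]]]] := hD p lp.
  have mi : (index p' (enum D) < M.+1)%N.
    by rewrite ltnS; apply: leq_trans (index_size _ _) _; rewrite -cardE.
  exists (Some (Ordinal mi, i, j)), (Ordinal mi), i, j, p'; split=> //=.
  by rewrite (nth_map p') ?index_mem ?mem_enum // nth_index ?mem_enum.
have [g hg] := choice hm.
exists ([ffun p => labels x (val p)], [ffun p => [ffun t : 'I_T.+1 => tr p t]],
  [ffun p => g p], [ffun mt : 'I_M.+1 * 'I_(n + T) =>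
     if nth None e mt.1 is Some p' then tr p' mt.2 else None]).
split=> [p|p t tn]; first by rewrite /= ffunE.
rewrite /decode /=; case: insubP => [t' _ tt'|]; first by rewrite !ffunE tt'.
rewrite -leqNgt => Tt; rewrite ffunE; have := hg p.
case lp : (long (labels x) p); last first.
  move=> ->; rewrite /trace; case E: (run _ _ t) => [y|//].
  by move: lp; rewrite /long (run_le (ltnW Tt)) // E.
move=> [m [i [j [p' [-> np' ee]]]]].
have iT := ltn_ord i; have jT := ltn_ord j.
rewrite /look; case: insubP => [t' _ tt'|]; last by lia.
rewrite ffunE /= np' tt' /tr /trace addnC.
case E: (path x (window_state p) i) ee => [y|].
  by move=> /esym E'; rewrite (runD _ E') -(runD _ E) subnKC //; lia.
by move: lp; rewrite /long => /(run_le (leq_ord i)); rewrite -/(path x (window_state p) i) E.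
Qed.

Lemma words_code : (#|words F n route| <= #|code|)%N.
Proof.
have [w0 w0W|none] := pickP (mem (words F n route)); last first.
  by rewrite (eq_card none) card0.
have enc w : w \in words F n route -> exists c : code, exists x, [/\ w = word F n route x,
      forall p : F, c.1.1.1 p = labels x (val p) &
      forall p t, (t < n)%N -> trace x (window_state p) t = decode c p t].
  rewrite /words finset.inE => /asboolP[x wx].
  by have [c [h1 h2]] := encode x; exists c, x.
have [c0 _] := enc w0 w0W.
have ex w : exists c : code, w \in words F n route -> exists x, [/\ w = word F n route x,
      forall p : F, c.1.1.1 p = labels x (val p) &
      forall p t, (t < n)%N -> trace x (window_state p) t = decode c p t].
  by case wW : (w \in words F n route); [have [c] := enc w wW; exists c | exists c0].
have [f hf] := choice ex.
apply: (@leq_card_in _ _ f) => w w' /hf[x [-> h1 h2]] /hf[y [-> h1' h2']] e.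
apply: word_eq => [p pF|p q t pF tn].
  by have := h1 [` pF]%fset; have := h1' [` pF]%fset; rewrite e => <- <-.
have := h2 ([` pF]%fset, q) t tn; have := h2' ([` pF]%fset, q) t tn.
by rewrite e => <- <-.
Qed.

Lemma card_code : #|code| =
  (#|{ffun F -> A}| * #|{ffun P -> {ffun 'I_T.+1 -> bb}}| *
   #|{ffun P -> option ('I_M.+1 * 'I_T.+1 * 'I_T.+1)}| * (5 ^ M.+1) ^ (n + T))%N.
Proof.
rewrite !card_prod; congr (_ * _)%N.
by rewrite card_ffun card_option card_prod !card_bool card_prod !card_ord expnM.
Qed.

End Window.

(** The base of the exponential is the same for all windows, only the factor
    depends on F; so the supremum defining the entropy is finite. *)
Lemma words_upper (F : {fset pos}) : exists c : nat, forall n,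
  (#|words F n route| <= c * (5 ^ M.+1) ^ n)%N.
Proof.
have [r hr] : exists r, forall p l, p \in F -> `|p ord0 l| <= r%:Z.
  exists (\max_(p : F) \max_l absz (val p ord0 l)) => p l pF.
  rewrite -abszE lez_nat.
  apply: leq_trans (@leq_bigmax F (fun p => \max_l absz (val p ord0 l)) [` pF]%fset).
  exact: (@leq_bigmax 'I_d (fun l => absz (p ord0 l)) l).
have [N [T [rN covNT]]] := cov r.+1.
eexists => n; apply: leq_trans (words_code hr rN covNT n) _.
rewrite card_code expnD [(_ ^ n * _)%N]mulnC mulnA; exact: leqnn.
Qed.

End Upper.

(** * Lower bound on the number of words *)
Section Lower.
Variable K : nat.
Hypothesis cov : covering K.
Variables (a : pos -> A) (s0 : state).
Hypothesis inf : forall n, isSome (run (nxt a) s0 n).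
Hypothesis d0 : (0 < d)%N.

(** An eventually periodic orbit visits finitely many cells, fewer than the N^d
    that the covering property asks for when N exceeds their number. *)
Lemma run_inj : injective (run (nxt a) s0).
Proof.
suff lt i j : (i < j)%N -> run (nxt a) s0 i <> run (nxt a) s0 j.
  by move=> i j e; case: (ltngtP i j) => // /lt; rewrite e.
move=> ij e.
(* From the repetition on, the orbit stays among its first j states. *)
have per n : exists2 m, (m < j)%N & run (nxt a) s0 n = run (nxt a) s0 m.
  elim: n => [|n [m mj em]]; first by exists 0%N => //; exact: leq_ltn_trans ij.
  have [mj'|mj'] := ltnP m.+1 j; first by exists m.+1; rewrite // !runS em.
  by exists i => //; rewrite runS em -runS e; congr (run _ _ _); lia.
have [N [T [jN h]]] := cov j.+1.
have [f [fi hf]] := h _ _ (inf T).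
have ex k : exists m : 'I_j, exists q, run (nxt a) s0 m = Some (f k, q).
  have [_ [i' [q [_ E]]]] := hf k; have [m mj em] := per i'.
  by exists (Ordinal mj), q; rewrite /= -em.
have [g hg] := choice ex.
have gi : injective g.
  move=> k k' gk; apply: fi; have [q E] := hg k; have [q' E'] := hg k'.
  by move: E; rewrite gk E' => -[].
have := leq_card _ gi; rewrite card_ffun !card_ord leqNgt => /negP; apply.
apply: leq_trans jN _; rewrite -[X in (X <= _)%N]expn1.
by case: (N) => [|N'] //; rewrite leq_pexp2l.
Qed.

(** The i-th state of the orbit carries the bit b i as its second bit. *)
Definition seed n (b : {ffun 'I_n -> bool}) : shift := fun z =>
  (a z, [ffun q => (false, [exists i : 'I_n, (run (nxt a) s0 i == Some (z, q)) && b i])]).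

(** The history of the single cell at the start reveals the bits of the seed one
    after the other. *)
Lemma words_lower n : (2 ^ n <= #|words [fset s0.1]%fset n route|)%N.
Proof.
have -> : (2 ^ n = #|{ffun 'I_n -> bool}|)%N by rewrite card_ffun card_bool card_ord.
pose f (b : {ffun 'I_n -> bool}) := word [fset s0.1]%fset n route (seed b).
have labels_seed (b : {ffun 'I_n -> bool}) : labels (seed b) = a by [].
have bits_seed (b : {ffun 'I_n -> bool}) (i : 'I_n) s : run (nxt a) s0 i = Some s ->
    bits (seed b) s = (false, b i).
  case: s => z q E; rewrite /bits /= ffunE; congr (_, _).
  apply/existsP/idP => [[j /andP[/eqP e bj]]|bi]; last by exists i; rewrite E eqxx.
  by rewrite (_ : i = j) //; apply/val_inj/run_inj; rewrite E e.
have fi : injective f.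
  move=> b b' /ffunP e; apply/ffunP.
  suff H m (lt : (m < n)%N) : b (Ordinal lt) = b' (Ordinal lt) by move=> [m lt].
  have [k] := ubnP m; elim: k m lt => // k IH m lt mk.
  case E : (run (nxt a) s0 m) (inf m) => [s|//] _.
  have tr i : (i < m)%N -> trace (seed b) s0 i = trace (seed b') s0 i.
    move=> im; rewrite /trace !labels_seed; case Ei : (run _ _ _) => [s'|//] /=.
    have lti := ltn_trans im lt.
    rewrite (bits_seed b (Ordinal lti) s' Ei) (bits_seed b' (Ordinal lti) s' Ei).
    by rewrite (IH i lti) //; lia.
  have := @trace_lead m (seed b) (seed b') s0 s s E E tr.
  rewrite (bits_seed b (Ordinal lt) s E) (bits_seed b' (Ordinal lt) s E) /=.
  have -> : bits (iter m route (seed b)) s0 = bits (iter m route (seed b')) s0.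
    have p0 : s0.1 \in [fset s0.1]%fset by rewrite inE.
    have /ffunP/(_ [` p0]%fset) := e (Ordinal lt).
    by rewrite !ffunE /= /bits => ->.
  by move=> /addbI.
have := card_codom fi; rewrite cardT -cardE => <-.
apply/subset_leq_card/fintype.subsetP => w /codomP[b ->].
by rewrite /words finset.inE; apply/asboolP; exists (seed b).
Qed.

End Lower.
End Routed.

(** * From word counts to entropy *)
Section Entropy.
Variable R : realType.

Lemma nat_above (x : R) : exists N : nat, x <= N%:R.
Proof.
exists (Num.bound `|x|).
exact: le_trans (ler_norm x) (ltW (archi_boundP (normr_ge0 x))).
Qed.

Lemma ln_nat_ge0 k : 0 <= ln (k%:R : R).
Proof. by case: k => [|k]; [rewrite ln0 | apply: ln_ge0; rewrite ler1n]. Qed.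

(** Fekete's lemma for a nonnegative subadditive sequence: dividing n by m with
    remainder, u n is at most (n / m) u m plus a constant that depends on m only,
    so u n / n comes as close to its infimum as u m / m does. *)
Lemma fekete (u : nat -> R) : (forall n, 0 <= u n) ->
  (forall m n, u (m + n)%N <= u m + u n) -> cvgn (fun n => u n / n%:R).
Proof.
move=> u0 sub; pose E := range (fun n => u n.+1 / n.+1%:R).
have E0 x : E x -> 0 <= x by move=> [n _ <-]; apply: divr_ge0.
have hE : has_inf E.
  by split; [exists (u 1%N / 1%:R), 0%N | exists 0 => x /E0].
apply/cvg_ex; exists (inf E); apply/cvgrPdist_le => e e0.
have e20 : 0 < e / 2 by rewrite divr_gt0.
have [_ [k _ <-] lt] := inf_adherent e20 hE.
set m := k.+1 in lt; have m0 : (0 < m%:R :> R) by rewrite ltr0n.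
pose B := \sum_(i < m) u i.
have uB r : (r < m)%N -> u r <= B.
  move=> rm; rewrite /B (bigD1 (Ordinal rm)) //= lerDl sumr_ge0 // => i _; exact: u0.
have uq q r : u (q * m + r)%N <= q%:R * u m + u r.
  elim: q => [|q IH]; first by rewrite mul0r add0r.
  rewrite mulSn -addnA; apply: le_trans (sub _ _) _.
  by rewrite -natr1 mulrDl mul1r [_ * _ + _]addrC -addrA lerD2l.
have [N hN] := nat_above (B / (e / 2)).
exists N.+1 => // n /= Nn; have n0 : (0 < n)%N by exact: leq_ltn_trans Nn.
have nR : (0 < n%:R :> R) by rewrite ltr0n.
have lo : inf E <= u n / n%:R.
  by apply: ge_inf; [exists 0 => x /E0 | exists n.-1; rewrite // prednK].
rewrite distrC ger0_norm ?subr_ge0 // lerBlDl.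
have hn : u n <= (n %/ m)%:R * u m + B.
  rewrite {1}(divn_eq n m); apply: le_trans (uq _ _) _.
  by rewrite lerD2l; apply: uB; rewrite ltn_mod.
have h1 : (n %/ m)%:R * u m / n%:R <= u m / m%:R.
  rewrite ler_pdivrMr // mulrAC ler_pdivlMr // mulrAC mulrC ler_wpM2l //.
  by rewrite -natrM ler_nat leq_divM.
have h2 : B / n%:R <= e / 2.
  rewrite ler_pdivrMr // mulrC -ler_pdivrMr //; apply: le_trans hN _.
  by rewrite ler_nat; exact: ltnW.
have : u n / n%:R <= u m / m%:R + e / 2.
  apply: le_trans (lerD h1 h2); rewrite -mulrDl ler_pM2r ?invr_gt0 //.
have := ltW lt; lra.
Qed.

Variables (d : nat) (S : finType) (T : full_shift d S -> full_shift d S).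
Implicit Types F : {fset 'rV[int]_d}.

(** A word of length m + n is a word of length m followed by the word of length n
    that starts from the image under T^m. *)
Lemma words_sub F m n : (#|words F (m + n) T| <= #|words F m T| * #|words F n T|)%N.
Proof.
pose f (w : {ffun 'I_(m + n) -> {ffun F -> S}}) :
    {ffun 'I_m -> {ffun F -> S}} * {ffun 'I_n -> {ffun F -> S}} :=
  ([ffun i => w (lshift n i)], [ffun i => w (rshift m i)]).
have fi : injective f.
  move=> w w' [/ffunP e1 /ffunP e2]; apply/ffunP => i.
  case: (split_ordP i) => j ->; first by have := e1 j; rewrite !ffunE.
  by have := e2 j; rewrite !ffunE.
rewrite -cardsX -(card_imset _ fi); apply/subset_leq_card/fintype.subsetP => _ /imsetP[w + ->].
rewrite !finset.inE => /asboolP[x ->]; apply/andP; split; apply/asboolP.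
  by exists x; apply/ffunP => i; rewrite !ffunE.
exists (iter m T x); apply/ffunP => i; rewrite !ffunE; apply/ffunP => p.
by rewrite !ffunE /= addnC iterD.
Qed.

Lemma entropy_cvg F : cvgn (fun n : nat => ln (#|words F n T|%:R : R) / n%:R).
Proof.
apply: (@fekete (fun n => ln (#|words F n T|%:R))) => [n|m n].
  exact: ln_nat_ge0.
have := words_sub F m n.
case: (posnP #|words F (m + n) T|) => [->|p] h.
  by rewrite ln0 //; apply: addr_ge0; exact: ln_nat_ge0.
have := leq_trans p h; rewrite muln_gt0 => /andP[p1 p2].
rewrite -lnM ?posrE ?ltr0n // -natrM ler_ln ?posrE ?ltr0n ?muln_gt0 ?p1 //.
by rewrite ler_nat.
Qed.

Lemma entropy_gt0 F : (forall n, (2 ^ n <= #|words F n T|)%N) ->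
  (0 < topological_entropy R T)%E.
Proof.
move=> h; apply: lt_le_trans (ereal_sup_ubound _); last by exists F.
rewrite lte_fin; apply: (@lt_le_trans _ _ (ln 2)); first by rewrite ln_gt0 // ltr1n.
apply: limr_ge; first exact: entropy_cvg.
exists 1%N => // n /= n1; rewrite ler_pdivlMr ?ltr0n // mulr_natr -lnXn //.
have W0 : (0 < #|words F n T|)%N by apply: leq_trans (h n); rewrite expn_gt0.
by rewrite -natrX ler_ln ?posrE ?ltr0n ?expn_gt0 // ler_nat.
Qed.

(** The factor c disappears after division by n; the bound ln b + 1, in place of
    ln b, leaves room for it at finite n. *)
Lemma entropy_lty (b : nat) : (0 < b)%N ->
  (forall F, exists c : nat, forall n, (#|words F n T| <= c * b ^ n)%N) ->
  (topological_entropy R T < +oo)%E.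
Proof.
move=> b0 h; apply: (@le_lt_trans _ _ (ln b%:R + 1)%:E); last exact: ltry.
apply: ub_ereal_sup => _ [F _ <-]; rewrite lee_fin.
apply: limr_le; first exact: entropy_cvg.
have [c hc] := h F.
have lb0 := ln_nat_ge0 b.
have [N hN] := nat_above (ln (c%:R : R)).
exists N.+1 => // n /= Nn; have n0 : (0 < n)%N by exact: leq_ltn_trans Nn.
rewrite ler_pdivrMr ?ltr0n // mulrDl mul1r.
have Nn' : N%:R <= n%:R :> R by rewrite ler_nat; exact: ltnW.
case: (posnP #|words F n T|) => [->|p].
  by rewrite ln0 // addr_ge0 // mulr_ge0.
have c0 : (0 < c)%N by have := leq_trans p (hc n); rewrite muln_gt0 => /andP[].
have : ln (#|words F n T|%:R : R) <= ln ((c * b ^ n)%:R : R).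
  by rewrite ler_ln ?posrE ?ltr0n ?muln_gt0 ?c0 ?expn_gt0 ?b0 // ler_nat.
rewrite natrM lnM ?posrE ?ltr0n ?expn_gt0 ?b0 // natrX lnXn ?ltr0n // -mulr_natr.
lra.
Qed.

End Entropy.

(** Reduces the theorem to the choice of labels and of a routing map. The set Q of
    internal states is part of the choice; for the Peano path it holds the signs
    of the heading. *)
Lemma route_entropy (R : realType) (d K : nat) (A Q : finType)
    (nxt : ('rV[int]_d -> A) -> 'rV[int]_d * Q -> option ('rV[int]_d * Q))
    (a : 'rV[int]_d -> A) (s : 'rV[int]_d * Q) :
  (0 < d)%N ->
  (forall a m z q, nxt (fun n => a (n + m)) (z, q) =
     omap (fun s => (s.1 - m, s.2)) (nxt a (z + m, q))) ->
  (forall z q, exists B : seq 'rV[int]_d, forall a a',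
     (forall w, w \in B -> a w = a' w) -> nxt a (z, q) = nxt a' (z, q)) ->
  covering nxt K -> (forall n, isSome (run (nxt a) s n)) ->
  exists (S : finType) (T : full_shift d S -> full_shift d S),
    [/\ cellular_automaton T, set_surj setT setT T &
        (0 < topological_entropy R T < +oo)%E].
Proof.
move=> d0 eqv loc cov inf; exists (alphabet A Q), (route nxt); split.
- exact: route_ca.
- exact: route_surj.
apply/andP; split.
  by apply: (@entropy_gt0 R _ _ _ [fset s.1]%fset) => n; exact: (words_lower cov inf).
by apply: entropy_lty (words_upper cov); rewrite expn_gt0.
Qed.

(** * Ternary digits and signed directions *)
(** Directions are pairs of an axis and a boolean t, true for the positive one.
    The three siblings along an axis have the digits 0, 1, 2 = -1; [last_digit] t
    is the digit of the sibling that lies farthest on side t. *)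
Definition dsgn (t : bool) : 'Z_3 := if t then 1 else -1.
Definition zsgn (t : bool) : int := if t then 1 else -1.
Definition last_digit (t : bool) : 'Z_3 := if t then -1 else 0.

Lemma last_digit_step t : last_digit t + dsgn t = last_digit (~~ t).
Proof. by case: t; apply/val_inj. Qed.

Lemma first_digit_step t : last_digit (~~ t) + dsgn t = 1.
Proof. by case: t; apply/val_inj. Qed.

Lemma mid_digit_step t : 1 + dsgn t = last_digit t.
Proof. by case: t; apply/val_inj. Qed.

Lemma first_digit_neq t : last_digit (~~ t) != last_digit t.
Proof. by case: t. Qed.

Lemma mid_digit_neq t : 1 != last_digit t.
Proof. by case: t. Qed.

Lemma digitP t (v : 'Z_3) : [\/ v = last_digit (~~ t), v = 1 | v = last_digit t].
Proof.
case: v => -[|[|[|//]]] i; case: t.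
- by constructor 1; apply/val_inj.
- by constructor 3; apply/val_inj.
- by constructor 2; apply/val_inj.
- by constructor 2; apply/val_inj.
- by constructor 3; apply/val_inj.
- by constructor 1; apply/val_inj.
Qed.

Lemma dsgn_neq t (v : 'Z_3) : v + dsgn t != v.
Proof. by rewrite -subr_eq0 addrAC subrr add0r; case: t. Qed.

(** One side at least of every box is an internal wall of its parent. *)
Lemma near_side_ex (v : 'Z_3) : exists t, v != last_digit t.
Proof. by case: (digitP true v) => ->; [exists true|exists true|exists false]. Qed.

Section Lattice.
Variable d : nat.
Definition pos := 'rV[int]_d.

Definition nbr (z : pos) (l : 'I_d) (t : bool) : pos :=
  z + \row_i (if i == l then zsgn t else 0).

Lemma nbrE z l t i : nbr z l t ord0 i = z ord0 i + (if i == l then zsgn t else 0).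
Proof. by rewrite !mxE. Qed.

Lemma zsgnN t : zsgn (~~ t) = - zsgn t.
Proof. by case: t; rewrite //= opprK. Qed.

Lemma nbrK z l t : nbr (nbr z l t) l (~~ t) = z.
Proof.
by apply/rowP => i; rewrite !nbrE zsgnN; case: eqP => _; rewrite ?addr0 ?addrK.
Qed.

Definition signs := {ffun 'I_d -> bool}.
(** A box is left at the corner opposite to its entry. In the adjacent box across
    the wall in direction D this is again a corner, whose opposite lies backward in
    all directions other than D. *)
Definition flip (D : 'I_d) (q : signs) : signs :=
  [ffun l => if l == D then q l else ~~ q l].

Lemma flipE D q l : flip D q l = if l == D then q l else ~~ q l.
Proof. by rewrite ffunE. Qed.

Lemma flip_id D q : flip D q D = q D.
Proof. by rewrite flipE eqxx. Qed.

Lemma flip_neq D q l : l != D -> flip D q l = ~~ q l.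
Proof. by rewrite flipE => /negbTE ->. Qed.

Lemma flipK D q : flip D (flip D q) = q.
Proof. by apply/ffunP => l; rewrite !flipE; case: eqP; rewrite ?negbK. Qed.

Definition cell_at (e : pos) (q : signs) (k : 'I_d -> nat) : pos :=
  \row_l (e ord0 l + zsgn (q l) * (k l)%:Z).

Lemma cell_atE e q k l : cell_at e q k ord0 l = e ord0 l + zsgn (q l) * (k l)%:Z.
Proof. by rewrite !mxE. Qed.

End Lattice.

(** * Certificates and the local rules of the Peano path *)
Section Peano.
Variable d' : nat.
Let d := d'.+2.
Local Notation pos := (pos d).
Local Notation signs := (signs d).

Definition digits := {ffun 'I_d -> 'Z_3}.
(** A certificate describes a box of some level m, whose first direction
    f = m mod d is that in which the boxes of level m + 1 are rows of three. Its
    entries are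
    - [cdig]: for each direction, the position of the box in the next larger box
      that extends it in that direction;
    - [cnext]: the position, in direction f, of the parent box of level m + 1;
    - [cside]: for each side, the [cdig] of the box that the wall on this side
      cuts;
    - [cparent]: the same for the two sides of the parent in direction f.
    The last two make the certificates of internal walls readable inside the box,
    although these walls can belong to boxes of any larger level. *)
Definition cert := (digits * 'Z_3 * {ffun 'I_d * bool -> digits} * {ffun bool -> digits})%type.
Definition cdig (c : cert) : digits := c.1.1.1.
Definition cnext (c : cert) : 'Z_3 := c.1.1.2.
Definition cside (c : cert) (l : 'I_d) (t : bool) : digits := c.1.2 (l, t).
Definition cparent (c : cert) (t : bool) : digits := c.2 t.

Lemma cert_eq (c c' : cert) : cdig c = cdig c' -> cnext c = cnext c' ->
  (forall l t, cside c l t = cside c' l t) -> (forall t, cparent c t = cparent c' t) -> c = c'.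
Proof.
case: c => [[[x y] s] h]; case: c' => [[[x' y'] s'] h'].
rewrite /cdig /cnext /cside /cparent /= => -> -> hs hh.
have -> : s = s' by apply/ffunP => -[l t]; exact: hs.
by have -> : h = h' by apply/ffunP => t; exact: hh.
Qed.

(** A site stores the certificate of its cell and those of its faces on the
    negative sides. *)
Definition label := (cert * {ffun 'I_d -> cert})%type.

(** The rule for two boxes with first direction f and certificates c, c', adjacent
    across a wall in direction l on side t, the wall having certificate g. If l is
    the first direction and the box is not the last one on this side, the wall is
    an internal wall of the common parent, so g certifies this parent: its
    positions agree with those of the box except in direction f, where they are
    given by [cnext], and siblings see the same walls in the other directions. If
    the box is the last one, the wall is also a wall of the
    parent, and crossing it moves the parent one step. *)
Definition compat (f l : 'I_d) (t : bool) (c c' g : cert) : Prop :=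
  [/\ forall i, cdig c' i = cdig c i + (if i == l then dsgn t else 0),
      cside c l t = cdig g &
      l = f ->
      if cdig c l != last_digit t then
        [/\ forall i, i != l -> cdig g i = cdig c i, cdig g l = cnext c,
            forall u, cside g l u = cparent c u &
            forall i u, i != l -> cside c' i u = cside c i u]
      else cparent c t = cside c l t /\ cnext c' = cnext c + dsgn t].

Section Config.
Variable a : pos -> label.

Definition cell_cert (z : pos) : cert := (a z).1.
Definition face_cert (l : 'I_d) (t : bool) (z : pos) : cert :=
  (a (if t then nbr z l true else z)).2 l.

Lemma face_cert_opp l t z : face_cert l (~~ t) (nbr z l t) = face_cert l t z.
Proof. by rewrite /face_cert; case: t => //=; rewrite nbrK. Qed.

(** At the edge of the cell z where the wall (j, s) meets the wall (l, t), the
    first is the lower one: (l, t) continues beyond it with the same certificate,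
    while (j, s) ends there, and the boxes that it cuts on the two sides of (l, t)
    are adjacent across (l, t). A box cut by a wall in direction j is a row in
    direction j, so its own first direction is the cyclic successor of j. *)
Definition lower (j : 'I_d) (s : bool) (l : 'I_d) (t : bool) (z : pos) : Prop :=
  face_cert l t z = face_cert l t (nbr z j s) /\
  compat (ordS j) l t (face_cert j s z) (face_cert j s (nbr z l t)) (face_cert l t z).

Definition good (z : pos) : Prop :=
  (forall l t, compat ord0 l t (cell_cert z) (cell_cert (nbr z l t)) (face_cert l t z)) /\
  (forall j s l t, j != l -> lower j s l t z \/ lower l t j s z).

(** The path leaves a cell through the lowest of the d walls that it is headed
    towards, so that the smallest unfinished row is continued first. *)
Definition exit_dir (z : pos) (q : signs) : option 'I_d :=
  if `[< good z >] then [pick D | `[< forall l, l != D -> lower D (q D) l (q l) z >]]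
  else None.

Definition peano (s : pos * signs) : option (pos * signs) :=
  omap (fun D => (nbr s.1 D (s.2 D), flip D s.2)) (exit_dir s.1 s.2).

Lemma peanoP z q s' : peano (z, q) = Some s' ->
  good z /\ exists D, (forall l, l != D -> lower D (q D) l (q l) z) /\
                      s' = (nbr z D (q D), flip D q).
Proof.
rewrite /peano /exit_dir /=; case: asboolP => // gz; case: pickP => // D /asboolP hD [<-].
by split=> //; exists D.
Qed.

(** * Boxes and their traversal *)
Fixpoint side_len (m : nat) (l : 'I_d) : nat :=
  if m is m'.+1 then (if l == inZp m' then 3 * side_len m' l else side_len m' l)%N else 1%N.

Lemma side_len_gt0 m l : (0 < side_len m l)%N.
Proof. by elim: m => //= m IH; case: ifP => // _; rewrite muln_gt0. Qed.

Definition inbox m (k : 'I_d -> nat) := forall l, (k l < side_len m l)%N.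

(** Boxes are given by the entry corner e and the heading q; the coordinates k of
    their cells are counted from e along q. *)
Definition exit_cell m (e : pos) (q : signs) : pos := cell_at e q (fun l => (side_len m l).-1).

Definition side_certs := 'I_d -> bool -> cert.

(** The rules that a traversed box of level m with certificate c satisfies on its
    own, as though it were a single cell: each of its sides is one wall with one
    certificate, recorded in S, and c is compatible with S. The part of the
    compatibility that mentions the adjacent box is left to [box_step], since only
    the boxes that the path visits are known to be good. *)
Record valid_box m (e : pos) (q : signs) (c : cert) (S : side_certs) : Prop := ValidBox {
  valid_good : forall k, inbox m k -> good (cell_at e q k);
  valid_side : forall k l t, inbox m k ->
    k l = (if t == q l then (side_len m l).-1 else 0%N) -> face_cert l t (cell_at e q k) = S l t;
  valid_cside : forall l t, cside c l t = cdig (S l t);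
  valid_near : forall t, let al : 'I_d := inZp m in cdig c al != last_digit t ->
    [/\ forall i, i != al -> cdig (S al t) i = cdig c i, cdig (S al t) al = cnext c &
        forall u, cside (S al t) al u = cparent c u];
  valid_far : forall t, let al : 'I_d := inZp m in cdig c al = last_digit t ->
    cparent c t = cside c al t }.

(** The relation between two boxes traversed in succession: the second is entered
    through the wall in direction D at the exit corner of the first, the
    certificates are compatible across this wall, and the walls on the other sides
    towards which the first box is headed continue along the second. *)
Definition box_step m e q c (S : side_certs) (D : 'I_d) e' q' c' (S' : side_certs) : Prop :=
  [/\ e' = nbr (exit_cell m e q) D (q D) /\ q' = flip D q,
      forall i, cdig c' i = cdig c i + (if i == D then dsgn (q D) else 0),
      D = inZp m -> (if cdig c D != last_digit (q D) then
         forall i u, i != D -> cside c' i u = cside c i u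
         else cnext c' = cnext c + dsgn (q D)),
      forall l, l != D -> S l (q l) = S' l (q l) &
      S' D (~~ q D) = S D (q D)].

(** A box of level m + 1 is traversed when its three rows are, in succession. The
    certificate of the box is that of its internal walls, and the third row is the
    last one on the side of the heading. The number of steps is recorded up to the
    entry into the third row: the step out of the box is not part of it. *)
Fixpoint traversal m (e : pos) (q : signs) (c : cert) (S : side_certs) : Prop :=
  valid_box m e q c S /\
  if m is m'.+1 then
    let al : 'I_d := inZp m' in
    exists e1 q1 e2 c0 S0 c1 S1 c2 S2,
    [/\ traversal m' e q c0 S0, traversal m' e1 q1 c1 S1, traversal m' e2 q c2 S2,
        box_step m' e q c0 S0 al e1 q1 c1 S1 /\ box_step m' e1 q1 c1 S1 al e2 q c2 S2 &
        [/\ run peano (e, q) (3 ^ m') = Some (e1, q1),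
            run peano (e1, q1) (3 ^ m') = Some (e2, q),
            cdig c2 al = last_digit (q al),
            c = S2 al (~~ q al) /\ S al (q al) = S2 al (q al) &
            forall l t, l != al -> S l t = S1 l t /\ S l t = S2 l t]]
  else c = cell_cert e.

Lemma traversal_valid m e q c S : traversal m e q c S -> valid_box m e q c S.
Proof. by case: m => [|m] []. Qed.

Lemma cell_at0 e q k : inbox 0 k -> cell_at e q k = e.
Proof.
move=> h; apply/rowP => l; rewrite cell_atE.
by move: (h l) => /=; case: (k l) => // _; rewrite mulr0 addr0.
Qed.

Lemma exit_cell0 e q : exit_cell 0 e q = e.
Proof. by apply: cell_at0 => l. Qed.

Lemma inZp0 : inZp 0 = ord0 :> 'I_d.
Proof. exact/val_inj. Qed.

Lemma traversal0 e q : good e -> traversal 0 e q (cell_cert e) (fun l t => face_cert l t e).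
Proof.
move=> ge; split=> //; case: (ge) => hc _; split.
- by move=> k /cell_at0 ->.
- by move=> k l t /cell_at0 ->.
- by move=> l t; case: (hc l t).
- move=> t /=; rewrite inZp0 => nr; case: (hc ord0 t) => _ _ /(_ erefl).
  by rewrite nr => -[].
- move=> t /=; rewrite inZp0 => nr; case: (hc ord0 t) => _ _ /(_ erefl).
  by rewrite nr eqxx /= => -[].
Qed.

(** A path that continues for the length of another box after the traversal of a
    box traverses an adjacent one. That its run is defined is the only assumption,
    so the existence of the next box is a consequence of local tests. *)
Definition next_traversal m := forall e q c S, traversal m e q c S ->
  isSome (run peano (e, q) (2 * 3 ^ m)) ->
  exists D e' q' c' S', [/\ run peano (e, q) (3 ^ m) = Some (e', q'),
    traversal m e' q' c' S' & box_step m e q c S D e' q' c' S'].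

(** For unit cells the claim is a reading of the tests made at two cells. *)
Lemma next_traversal0 : next_traversal 0.
Proof.
move=> e q c S [VS ->] def.
have [[e1 q1] E1] := run_some (isT : (1 <= 2 * 3 ^ 0)%N) def.
have [[e2 q2] E2] := run_some (isT : (2 <= 2 * 3 ^ 0)%N) def.
have N1 : peano (e, q) = Some (e1, q1) by [].
have N2 : peano (e1, q1) = Some (e2, q2) by move: E2; rewrite runS E1.
have [ge [D [hD [de1 dq1]]]] := peanoP N1.
have [ge1 _] := peanoP N2.
have hS l t : face_cert l t e = S l t.
  have := @valid_side _ _ _ _ _ VS (fun _ => 0%N) l t (fun=> isT).
  by rewrite /= if_same => /(_ erefl) <-; rewrite cell_at0.
exists D, e1, q1, (cell_cert e1), (fun l t => face_cert l t e1); split => //.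
  exact: traversal0.
have [hc _] := ge; have [h1 _ h3] := hc D (q D).
split.
- by rewrite exit_cell0.
- by rewrite de1.
- rewrite inZp0 => D0; move: (h3 D0); rewrite de1.
  by case: ifP => _ [].
- by move=> l lD; rewrite -hS de1; case: (hD l lD).
- by rewrite -hS de1 face_cert_opp.
Qed.

(** * From one level of boxes to the next *)
Section Level.
Variable m : nat.
Hypothesis next_m : next_traversal m.
Let al : 'I_d := inZp m.

(** A unit cell of the box that touches both the side (j, s) and the side (l, t):
    the tests at its edges compare the two walls. *)
Definition corner (q : signs) j s l t : 'I_d -> nat :=
  fun i => if i == j then (if s == q j then (side_len m j).-1 else 0%N)
           else if i == l then (if t == q l then (side_len m l).-1 else 0%N) else 0%N.

Lemma corner_in q j s l t : inbox m (corner q j s l t).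
Proof.
move=> i; rewrite /corner; have := side_len_gt0 m i.
case: eqP => [->|_]; first by case: ifP => _; lia.
by case: eqP => [->|_] //; case: ifP => _; lia.
Qed.

(** Coordinates in the next box are counted from its own entry, with reversed
    heading except in direction D. *)
Lemma nbr_next_box e q k D : inbox m k -> k D = (side_len m D).-1 ->
  nbr (cell_at e q k) D (q D) =
  cell_at (nbr (exit_cell m e q) D (q D)) (flip D q)
     (fun i => if i == D then 0%N else ((side_len m i).-1 - k i)%N).
Proof.
move=> kin kD; apply/rowP => i; rewrite !(nbrE, cell_atE) flipE.
case: eqP => [->|_]; first by rewrite kD mulr0 addr0.
rewrite !addr0 zsgnN; have := kin i; have := side_len_gt0 m i.
set L := side_len m i; set x := k i => L0 xL.
have -> : ((L.-1 - x)%N%:Z = (L.-1)%:Z - x%:Z)%R by lia.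
ring.
Qed.

(** A box that is not the last of its row is left along the row. Suppose that it
    is left in another direction D. Its exit side is an internal wall of the
    parent, and it is one and the same wall for the next box; both boxes read their
    own position in direction D from its certificate, but these positions differ
    by one. *)
Lemma near_exit e q c S D e' q' c' S' :
  valid_box m e q c S -> valid_box m e' q' c' S' -> box_step m e q c S D e' q' c' S' ->
  cdig c al != last_digit (q al) -> D = al.
Proof.
move=> V1 V2 [_ hdg _ hS _] nr; apply/eqP/negPn/negP => Dal.
have nr' : cdig c' al != last_digit (q al).
  by rewrite hdg [al == D]eq_sym (negbTE Dal) addr0.
have [h1 _ _] := valid_near V1 nr; have [h2 _ _] := valid_near V2 nr'.
have E : S al (q al) = S' al (q al) by apply: hS; rewrite eq_sym.
have := h2 D Dal; rewrite -E (h1 D Dal) hdg eqxx => /esym/eqP.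
by rewrite (negbTE (dsgn_neq _ _)).
Qed.

(** The walls of the second box on the sides other than D, seen from the cells of
    the first box next to the common wall. *)
Lemma cross_side e q c S e' q' c' S' D l t k :
  valid_box m e q c S -> valid_box m e' q' c' S' -> box_step m e q c S D e' q' c' S' ->
  l != D -> inbox m k -> k D = (side_len m D).-1 ->
  k l = (if t == q l then (side_len m l).-1 else 0%N) ->
  face_cert l t (nbr (cell_at e q k) D (q D)) = S' l t.
Proof.
move=> V1 V2 [[ee qq] _ _ _ _] lD kin kD kl.
rewrite nbr_next_box // -ee -qq (valid_side V2) //.
  move=> i; case: eqP => [->|_]; first exact: side_len_gt0.
  by have := side_len_gt0 m i; lia.
rewrite (negbTE lD) kl qq flip_neq //.
by case: (t) (q l) => [] []; rewrite /= ?subnn ?subn0.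
Qed.

Lemma ordS_neq (i : 'I_d) : ordS i != i.
Proof.
rewrite -val_eqE /=; have := ltn_ord i; rewrite /d leq_eqVlt => /orP[/eqP[->]|h].
  by rewrite modnn.
by rewrite modn_small //; lia.
Qed.

Lemma inZpS : inZp m.+1 = ordS al.
Proof. by apply/val_inj => /=; rewrite -addn1 -(addn1 (m %% _)) modnDml. Qed.

(** The wall between two siblings is lower than every side wall it meets: siblings
    have equal [cside] entries in the other directions, whereas a side wall ending
    at the common wall would change its position in direction al when crossing
    it. So side walls pass, and the certificate of the inner wall is compatible
    with them. *)
Lemma inner_wall_lower e q c S e' q' c' S' l t :
  valid_box m e q c S -> valid_box m e' q' c' S' -> box_step m e q c S al e' q' c' S' ->
  cdig c al != last_digit (q al) -> l != al ->
  S l t = S' l t /\ exists cp, compat (ordS al) l t (S al (q al)) cp (S l t).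
Proof.
move=> V1 V2 st nr lal; have [_ _ h3 _ _] := st.
(* The edge between the inner wall and the side (l, t), where the rule is read. *)
set k := corner q al (q al) l t.
have kin : inbox m k by exact: corner_in.
have kal : k al = (side_len m al).-1 by rewrite /k /corner eqxx eqxx.
have kl : k l = (if t == q l then (side_len m l).-1 else 0%N).
  by rewrite /k /corner (negbTE lal) eqxx.
have F1 : face_cert al (q al) (cell_at e q k) = S al (q al).
  by rewrite (valid_side V1) // eqxx.
have F2 : face_cert l t (cell_at e q k) = S l t by rewrite (valid_side V1).
have F3 : face_cert l t (nbr (cell_at e q k) al (q al)) = S' l t.
  exact: (cross_side V1 V2 st lal kin kal kl).
have dS : cdig (S' l t) = cdig (S l t).
  by rewrite -(valid_cside V1) -(valid_cside V2); move: (h3 erefl); rewrite nr => ->.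
have [_ ed] := valid_good V1 kin.
have alal : al != l by rewrite eq_sym.
case: (ed al (q al) l t alal) => [[]|[_ []]].
  by rewrite F1 F2 F3 => -> h; split=> //; eexists; exact: h.
rewrite F2 F3 => /(_ al); rewrite eqxx dS => /esym/eqP.
by rewrite (negbTE (dsgn_neq _ _)).
Qed.

(** Cells of a row are found in its middle box with reversed coordinates, since
    that box is traversed with reversed heading; reversing twice, the last box has
    the heading of the first, and its exit is that of the row. *)
Lemma middle_box_cell e q k : (side_len m al <= k al)%N -> (forall i, i != al -> (k i < side_len m i)%N) ->
  cell_at e q k = cell_at (nbr (exit_cell m e q) al (q al)) (flip al q)
    (fun i => if i == al then (k al - side_len m al)%N else ((side_len m i).-1 - k i)%N).
Proof.
move=> kal kin; apply/rowP => i; rewrite !(nbrE, cell_atE) flipE.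
case: (eqVneq i al) => [->|ne].
  have L0 := side_len_gt0 m al; move: kal; set L := side_len m al in L0 *; set x := k al => xL.
  have -> : ((x - L)%N%:Z = x%:Z - (L.-1)%:Z - 1)%R by lia.
  ring.
rewrite !addr0 zsgnN; have := kin i ne; have := side_len_gt0 m i.
set L := side_len m i; set x := k i => L0 xL.
have -> : ((L.-1 - x)%N%:Z = (L.-1)%:Z - x%:Z)%R by lia.
ring.
Qed.

Lemma last_box_cell e q k e1 q1 : (2 * side_len m al <= k al)%N ->
  (forall i, i != al -> (k i < side_len m i)%N) ->
  e1 = nbr (exit_cell m e q) al (q al) -> q1 = flip al q ->
  cell_at e q k = cell_at (nbr (exit_cell m e1 q1) al (q1 al)) q
    (fun i => if i == al then (k al - 2 * side_len m al)%N else k i).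
Proof.
move=> kal kin -> ->; rewrite middle_box_cell //; last by lia.
rewrite middle_box_cell.
- rewrite flipK; apply/rowP => i; rewrite !cell_atE; congr (_ + _ * _%:Z).
  case: (eqVneq i al) => [_|ne]; first by rewrite eqxx; lia.
  by have := kin i ne; lia.
- by rewrite eqxx; lia.
- by move=> i ne; have := kin i ne; rewrite (negbTE ne); lia.
Qed.

Lemma exit_triple e q e1 q1 : e1 = nbr (exit_cell m e q) al (q al) -> q1 = flip al q ->
  exit_cell m (nbr (exit_cell m e1 q1) al (q1 al)) q = exit_cell m.+1 e q.
Proof.
move=> he hq; have L0 := side_len_gt0 m al; rewrite [RHS](last_box_cell _ _ he hq) /= -/al.
- apply/rowP => i; rewrite !cell_atE; congr (_ + _ * _%:Z).
  case: (eqVneq i al) => [->|ne] //=; first by rewrite eqxx; lia.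
- by rewrite eqxx; lia.
- by move=> i ne; rewrite (negbTE ne); have := side_len_gt0 m i; lia.
Qed.

(** Three siblings in succession form a valid box of the next level. Its
    certificate is that of the inner walls, once the two inner walls W and W' are
    known to have equal certificates. Their positions agree since the middle box
    reads both. For [cnext] and [cparent], choose a side in the direction following
    al on which the parent is not the last one: the wall there is shared by W and
    W', and compatibility in the first direction of the parent expresses these
    entries through the certificate of this wall. *)
Lemma triple_valid e q e1 q1 e2 c0 S0 c1 S1 c2 S2 :
  valid_box m e q c0 S0 -> valid_box m e1 q1 c1 S1 -> valid_box m e2 q c2 S2 ->
  box_step m e q c0 S0 al e1 q1 c1 S1 -> box_step m e1 q1 c1 S1 al e2 q c2 S2 ->
  cdig c0 al = last_digit (~~ q al) ->
  [/\ cdig c2 al = last_digit (q al), S2 al (~~ q al) = S0 al (q al),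
      forall l t, l != al -> S0 l t = S1 l t /\ S0 l t = S2 l t &
      valid_box m.+1 e q (S0 al (q al))
        (fun l t => if (l == al) && (t == q al) then S2 l t else S0 l t)].
Proof.
move=> V0 V1 V2 st0 st1 start.
have [[ee1 qq1] d01 n01 _ W01] := st0; have [[ee2 _] d12 n12 _ W12] := st1.
have q1al : q1 al = q al by rewrite qq1 flip_id.
have nr0 : cdig c0 al != last_digit (q al) by rewrite start first_digit_neq.
have dc1 : cdig c1 al = 1 by rewrite d01 eqxx start first_digit_step.
have nr1 : cdig c1 al != last_digit (q1 al) by rewrite dc1 mid_digit_neq.
have dc2 : cdig c2 al = last_digit (q al) by rewrite d12 eqxx q1al dc1 mid_digit_step.
rewrite q1al in W12.
have w0 l t (ll : l != al) := inner_wall_lower t V0 V1 st0 nr0 ll.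
have w1 l t (ll : l != al) := inner_wall_lower t V1 V2 st1 nr1 ll.
rewrite q1al in w1.
set W := S0 al (q al) in W01 w0 *; set W' := S1 al (q al) in W12 w1.
have sides l t : l != al -> S0 l t = S1 l t /\ S0 l t = S2 l t.
  by move=> ll; have [h _] := w0 l t ll; have [h' _] := w1 l t ll; rewrite h.
have aS : ordS al != al by exact: ordS_neq.
have [B1 B2 B3] := valid_near V0 nr0.
have nr1' : cdig c1 al != last_digit (~~ q al) by rewrite dc1 mid_digit_neq.
have nr1q : cdig c1 al != last_digit (q al) by rewrite dc1 mid_digit_neq.
have [C1 C2 C3] := valid_near V1 nr1q; have [C1' C2' C3'] := valid_near V1 nr1'.
rewrite -/al -/W in B1 B2 B3; rewrite -/al -/W' in C1 C2 C3.
rewrite -/al W01 in C1' C2' C3'.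
have dgW : cdig W' = cdig W.
  apply/ffunP => i; case: (eqVneq i al) => [->|ne]; first by rewrite C2 C2'.
  by rewrite C1 // C1'.
have WW : W' = W.
  have [t nrt] := near_side_ex (cdig W (ordS al)).
  have [e0 [cp [_ _ h0]]] := w0 _ t aS; have [_ [cp' [_ _ h1]]] := w1 _ t aS.
  move: (h0 erefl) (h1 erefl); rewrite dgW nrt -e0 => -[_ n0 t0 _] [_ n1 t1 _].
  apply: cert_eq => //.
  - by rewrite -n0 -n1.
  - move=> l u; case: (eqVneq l al) => [->|ne]; first by rewrite C3 C3'.
    have [E1 [cp1 [_ -> _]]] := w0 _ u ne; have [_ [cp2 [_ -> _]]] := w1 _ u ne.
    by rewrite E1.
  - by move=> u; rewrite -t0 -t1.
split=> //; first by rewrite W12 WW.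
have L0 := side_len_gt0 m al.
(* Goodness of cells and certificates of walls are known for the cells of the
   three boxes, in the coordinates of these boxes. *)
have cut k : inbox m.+1 k ->
  [\/ [/\ inbox m k & (k al < side_len m al)%N],
      [/\ (side_len m al <= k al)%N, inbox m (fun i => if i == al then (k al - side_len m al)%N
             else ((side_len m i).-1 - k i)%N),
         (k al < 2 * side_len m al)%N & cell_at e q k = cell_at e1 q1
         (fun i => if i == al then (k al - side_len m al)%N else ((side_len m i).-1 - k i)%N)]
    | [/\ (2 * side_len m al <= k al)%N, (k al < 3 * side_len m al)%N,
          inbox m (fun i => if i == al then (k al - 2 * side_len m al)%N else k i) &
          cell_at e q k = cell_at e2 q
         (fun i => if i == al then (k al - 2 * side_len m al)%N else k i)]].
  move=> kin; have kn i (ne : i != al) : (k i < side_len m i)%N.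
    by move: (kin i) => /=; rewrite -/al (negbTE ne).
  have ka : (k al < 3 * side_len m al)%N by move: (kin al) => /=; rewrite -/al eqxx.
  have [lt1|le1] := ltnP (k al) (side_len m al).
    by constructor 1; split=> // i; case: (eqVneq i al) => [->|/kn].
  have [lt2|le2] := ltnP (k al) (2 * side_len m al).
    constructor 2; split=> //; last by rewrite ee1 qq1 -middle_box_cell.
    move=> i; case: (eqVneq i al) => [->|ne]; first by clear -lt2 L0; lia.
    by case: (side_len m i) (kn i ne) => // L _; rewrite ltnS leq_subr.
  constructor 3; split=> //; last by rewrite ee2 -(last_box_cell le2 kn ee1 qq1).
  move=> i; case: (eqVneq i al) => [->|ne]; first by clear -ka L0; lia.
  exact: kn.
split.
- move=> k kin; case: (cut k kin) => [[kk _]|[_ kk _ ->]|[_ _ kk ->]].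
  + exact: (valid_good V0).
  + exact: (valid_good V1).
  + exact: (valid_good V2).
- move=> k l t kin kl.
  have kl' : l != al -> k l = (if t == q l then (side_len m l).-1 else 0%N).
    by move=> ll; move: kl => /=; rewrite -/al (negbTE ll).
  have kal : l = al -> k al = (if t == q al then (3 * side_len m al).-1 else 0%N).
    by move=> le; move: kl => /=; rewrite le -/al eqxx.
  case: (cut k kin) => [[kk lt]|[lb kk ub ->]|[lb ub kk ->]].
  + case: (eqVneq l al) => [le|ne] /=.
      rewrite le in kal *; move: (kal erefl).
      case: (eqVneq t (q al)) => /= [_ kz|tq kz]; first by clear -lt kz L0; lia.
      by rewrite (valid_side V0) //; rewrite -/al kz (negbTE tq).
    by rewrite (valid_side V0) // kl'.
  + case: (eqVneq l al) => [le|ne] /=.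
      rewrite le in kal *; by move: (kal erefl); case: ifP => _ kz; clear -lb ub kz L0; lia.
    rewrite (valid_side V1) //; first by have [->] := sides l t ne.
    rewrite (negbTE ne) kl' // qq1 flip_neq //.
    by case: (t) (q l) => [] []; rewrite /= ?subnn ?subn0.
  + case: (eqVneq l al) => [le|ne] /=.
      rewrite le in kal *; move: (kal erefl).
      case: (eqVneq t (q al)) => /= [-> kz|tq kz]; last by clear -lb kz L0; lia.
      by rewrite (valid_side V2) //; rewrite -/al !eqxx kz; clear -L0; lia.
    rewrite (valid_side V2) //; first by have [_ ->] := sides l t ne.
    by rewrite (negbTE ne) kl'.
- move=> l t; case: (eqVneq l al) => [->|ne] /=; last first.
    by have [_ [cp [_ -> _]]] := w0 _ t ne.
  case: (eqVneq t (q al)) => [->|tq].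
    rewrite -WW C3 -(valid_cside V2); have := valid_far V2 dc2; rewrite -/al => <-.
    have nr2 : cdig c2 al != last_digit (~~ q al) by rewrite dc2 eq_sym first_digit_neq.
    by have [_ _ D3] := valid_near V2 nr2; rewrite -D3 -/al W12 C3.
  have -> : t = ~~ q al by case: (t) (q al) tq => [] [].
  by rewrite B3 -(valid_cside V0); have := valid_far V0 start.
- move=> t /=; rewrite inZpS -/al => nr.
  have [_ [cp [_ _ h]]] := w0 _ t aS.
  by move: (h erefl); rewrite nr (negbTE aS) => -[].
- move=> t /=; rewrite inZpS -/al => nr.
  have [_ [cp [_ _ h]]] := w0 _ t aS.
  by move: (h erefl); rewrite nr eqxx => -[].
Qed.

(** A path that enters the first box of a row traverses the row, because
    [near_exit] forces the first two exits. *)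
Lemma triple e q c0 S0 : traversal m e q c0 S0 -> cdig c0 al = last_digit (~~ q al) ->
  isSome (run peano (e, q) (3 ^ m.+1)) ->
  exists c S, traversal m.+1 e q c S /\
    [/\ c = S0 al (q al), forall l t, l != al -> S l t = S0 l t &
        S al (~~ q al) = S0 al (~~ q al)].
Proof.
move=> T0 start; rewrite expnS => def.
have V0 := traversal_valid T0.
have [D0 [e1 [q1 [c1 [S1 [run0 T1 st0]]]]]] : exists D e' q' c' S',
    [/\ run peano (e, q) (3 ^ m) = Some (e', q'), traversal m e' q' c' S' &
        box_step m e q c0 S0 D e' q' c' S'].
  by apply: next_m => //; apply: run_le def; rewrite leq_pmul2r ?expn_gt0.
have V1 := traversal_valid T1.
have D0al : D0 = al.
  by apply: (near_exit V0 V1 st0); rewrite start first_digit_neq.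
rewrite D0al in st0.
have def1 : isSome (run peano (e1, q1) (2 * 3 ^ m)).
  by rewrite -(runD _ run0) -[X in (X + _)%N]mul1n -mulnDl.
have [D1 [e2 [q2 [c2 [S2 [run1 T2 st1]]]]]] := next_m T1 def1.
have V2 := traversal_valid T2.
have [[ee1 qq1] d01 _ _ _] := st0.
have q1al : q1 al = q al by rewrite qq1 flip_id.
have D1al : D1 = al.
  by apply: (near_exit V1 V2 st1); rewrite d01 eqxx start first_digit_step mid_digit_neq.
rewrite D1al in st1.
have q2q : q2 = q by case: st1 => [[_ ->]] _ _ _ _; rewrite qq1 flipK.
rewrite q2q in run1 T2 V2 st1.
have [dc2 WW sides V3] := triple_valid V0 V1 V2 st0 st1 start.
have nq : (~~ q al == q al) = false by case: (q al).
exists (S0 al (q al)), (fun l t => if (l == al) && (t == q al) then S2 l t else S0 l t).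
split; last first.
  split=> // [l t ne|]; first by rewrite (negbTE ne).
  by rewrite nq andbF.
split=> //; exists e1, q1, e2, c0, S0, c1, S1, c2, S2; split=> //; split=> //.
  by rewrite -/al WW !eqxx.
by move=> l t; rewrite -/al => ne; rewrite (negbTE ne) /=; exact: sides.
Qed.

(** The third box of a row is left through some wall D into a box that is the first
    of its row: either D is the direction of the row, and the position wraps
    around, or the heading along the row is reversed, so that the side where the
    first row ended is where the next one begins. This next row is then traversed,
    and the relation between the two rows is left to check. If D is the direction
    al of the rows, both parents are read off the boxes on the two sides of D. If
    not, the rule at the edge between D and an inner wall shows that the inner
    walls of the two rows are compatible across D. *)
Lemma next_traversalS : next_traversal m.+1.
Proof.
move=> e q c S [VS [e1 [q1 [e2 [c0 [S0 [c1 [S1 [c2 [S2 [T0 T1 T2 [st0 st1]]]]]]]]]]]].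
rewrite -/al => -[run0 run1 dc2 [ec eS] sides] def.
have V1 := traversal_valid T1; have V2 := traversal_valid T2.
have run2 : run peano (e, q) (2 * 3 ^ m) = Some (e2, q).
  by rewrite mul2n -addnn (runD _ run0).
have def2 : isSome (run peano (e2, q) (4 * 3 ^ m)).
  by rewrite -(runD _ run2) -mulnDl; move: def; rewrite expnS mulnA.
have def2' : isSome (run peano (e2, q) (2 * 3 ^ m)).
  by apply: run_le def2; rewrite leq_pmul2r ?expn_gt0.
have [D [e3 [q3 [c3 [S3 [run3 T3 st2]]]]]] := next_m T2 def2'.
have V3 := traversal_valid T3; have [[ee3 qq3] d23 n23 x23 W23] := st2.
have [[ee1 qq1] _ _ _ _] := st0; have [[ee2 _] _ _ _ _] := st1.
have start : cdig c3 al = last_digit (~~ q3 al).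
  rewrite d23 dc2 qq3; case: (eqVneq al D) => [->|ne].
    by rewrite flip_id last_digit_step.
  by rewrite flip_neq // negbK addr0.
have def3 : isSome (run peano (e3, q3) (3 ^ m.+1)).
  by rewrite -(runD _ run3) expnS -[X in (X + _)%N]mul1n -mulnDl.
have [c' [S' [T' [cc' SS' Sal']]]] := triple T3 start def3.
exists D, e3, q3, c', S'; split=> //.
  by rewrite expnS (_ : 3 = 2 + 1)%N // mulnDl mul1n (runD _ run2).
have ex : e3 = nbr (exit_cell m.+1 e q) D (q D).
  by rewrite ee3 ee2 (exit_triple ee1 qq1).
have nq : (~~ q al == q al) = false by case: (q al).
have aS : ordS al != al by exact: ordS_neq.
case: (eqVneq D al) => [Dal|Dal].
  have q3al : q3 al = q al by rewrite qq3 Dal flip_id.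
  rewrite q3al in cc' Sal'; rewrite Dal in d23 n23 x23 W23.
  have nr2 : cdig c2 al != last_digit (~~ q al) by rewrite dc2 eq_sym first_digit_neq.
  have nr3 : cdig c3 al != last_digit (q al) by rewrite start q3al first_digit_neq.
  have [B1 B2 _] := valid_near V2 nr2; have [C1 C2 _] := valid_near V3 nr3.
  split; rewrite ?Dal; rewrite ?Dal in ex qq3 => //.
  - move=> i; rewrite ec cc'; case: (eqVneq i al) => [->|ne].
      rewrite C2 B2; move: (n23 erefl); rewrite -/al dc2 eqxx /= => ->; by [].
    by rewrite C1 // B1 // d23 (negbTE ne).
  - by rewrite inZpS -/al => /eqP; rewrite eq_sym (negbTE aS).
  - by move=> l ne; rewrite SS' // -x23 //; have [_ ->] := sides l (q l) ne.
  - by rewrite Sal' W23 eS.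
have q3al : q3 al = ~~ q al by rewrite qq3 flip_neq // eq_sym.
rewrite q3al in cc' Sal'; rewrite negbK in Sal'.
(* The inner wall ends at the wall D. Otherwise D would end at the inner wall and
   change its position in direction al there, but D is one wall along the row. *)
have HH : compat (ordS al) D (q D) c c' (S D (q D)).
  set k := corner q al (~~ q al) D (q D).
  have kin : inbox m k by exact: corner_in.
  have kal : k al = 0%N by rewrite /k /corner eqxx nq.
  have kD : k D = (side_len m D).-1 by rewrite /k /corner (negbTE Dal) !eqxx.
  have F1 : face_cert al (~~ q al) (cell_at e2 q k) = c by rewrite (valid_side V2) // nq.
  have F2 : face_cert D (q D) (cell_at e2 q k) = S D (q D).
    by rewrite (valid_side V2) ?eqxx //; have [_ ->] := sides D (q D) Dal.
  have F3 : face_cert al (~~ q al) (nbr (cell_at e2 q k) D (q D)) = c'.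
    by rewrite cc'; apply: (cross_side V2 V3 st2); rewrite ?nq // eq_sym.
  have F4 : face_cert D (q D) (nbr (cell_at e2 q k) al (~~ q al)) = S D (q D).
    have [-> _] := sides D (q D) Dal.
    (* The cell of the middle box that faces the cell k of the last box. *)
    set k1 := fun i => if i == al then (side_len m al).-1 else ((side_len m i).-1 - k i)%N.
    have k1in : inbox m k1.
      move=> i; rewrite /k1; have := side_len_gt0 m i.
      case: (eqVneq i al) => [->|_]; first by case: (side_len m al).
      by case: (side_len m i) => // L _; rewrite ltnS leq_subr.
    have k1al : k1 al = (side_len m al).-1 by rewrite /k1 eqxx.
    have q1al : q1 al = q al by rewrite qq1 flip_id.
    have -> : cell_at e2 q k = nbr (cell_at e1 q1 k1) al (q al).
      rewrite -q1al (nbr_next_box _ _ k1in) // -ee2.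
      have -> : flip al q1 = q by rewrite qq1 flipK.
      apply/rowP => i; rewrite !cell_atE /k1; congr (_ + _ * _%:Z).
      case: (eqVneq i al) => [->|_]; first by rewrite kal.
      by rewrite subKn //; case: (side_len m i) (kin i).
    rewrite nbrK (valid_side V1) // /k1 (negbTE Dal) kD subnn qq1 flip_neq //.
    by case: (q D).
  have [_ ed] := valid_good V2 kin.
  have alD : al != D by rewrite eq_sym.
  case: (ed al (~~ q al) D (q D) alD) => [[]|[_ []]].
    by rewrite F1 F2 F3.
  rewrite F2 F4 => /(_ al); rewrite eqxx => /esym/eqP.
  by rewrite (negbTE (dsgn_neq _ _)).
have [h1 h2 h3] := HH; split=> //.
- rewrite inZpS -/al => /h3; case: ifP => _ [] //.
- move=> l lD; case: (eqVneq l al) => [->|ne].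
    by rewrite Sal' eS x23 // eq_sym.
  by rewrite SS' // -x23 //; have [_ ->] := sides l (q l) ne.
- by rewrite SS' // W23; have [_ ->] := sides D (q D) Dal.
Qed.

End Level.

Lemma next_traversal_all m : next_traversal m.
Proof. by elim: m => [|m IH]; [exact: next_traversal0|exact: next_traversalS]. Qed.

(** * The path fills boxes near its start *)
Lemma traversal_cover m e q c S k : traversal m e q c S -> inbox m k ->
  exists i q', (i < 3 ^ m)%N /\ run peano (e, q) i = Some (cell_at e q k, q').
Proof.
elim: m e q c S k => [|m IH] e q c S k.
  by move=> _ kin; exists 0%N, q; rewrite cell_at0.
case=> _ [e1 [q1 [e2 [c0 [S0 [c1 [S1 [c2 [S2 [T0 T1 T2 [st0 st1]]]]]]]]]]].
set al : 'I_d := inZp m => -[run0 run1 _ _ _] kin.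
have [[ee1 qq1] _ _ _ _] := st0; have [[ee2 _] _ _ _ _] := st1.
have kn i (ne : i != al) : (k i < side_len m i)%N.
  by move: (kin i) => /=; rewrite -/al (negbTE ne).
have ka : (k al < 3 * side_len m al)%N by move: (kin al) => /=; rewrite -/al eqxx.
have run2 : run peano (e, q) (2 * 3 ^ m) = Some (e2, q).
  by rewrite mul2n -addnn (runD _ run0).
have [lt1|le1] := ltnP (k al) (side_len m al).
  have kin0 : inbox m k by move=> i; case: (eqVneq i al) => [->|/kn].
  have [i [q' [lti runi]]] := IH _ _ _ _ _ T0 kin0.
  by exists i, q'; split=> //; rewrite expnS; lia.
have [lt2|le2] := ltnP (k al) (2 * side_len m al).
  have [|i [q' [lti runi]]] := IH _ _ _ _ (fun i => if i == al then (k al - side_len m al)%N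
     else ((side_len m i).-1 - k i)%N) T1.
    move=> i; have := side_len_gt0 m i; case: (eqVneq i al) => [->|ne]; first by lia.
    by have := kn i ne; lia.
  exists (3 ^ m + i)%N, q'; rewrite expnS (runD _ run0) runi; split; first by lia.
  by rewrite ee1 qq1 -middle_box_cell.
have [|i [q' [lti runi]]] := IH _ _ _ _ (fun i => if i == al then (k al - 2 * side_len m al)%N
   else k i) T2.
  by move=> i; case: (eqVneq i al) => [->|/kn //]; lia.
exists (2 * 3 ^ m + i)%N, q'; rewrite expnS (runD _ run2) runi; split; first by lia.
by rewrite ee2 -(last_box_cell le2 kn ee1 qq1).
Qed.

(** To start a traversal at level m + 1, a path that traverses a box of level m has
    to reach the first box of a row. From the second position of a row this takes
    two more boxes, from the third one, which bounds the delay and the drift. *)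
Fixpoint wait m := if m is m'.+1 then (wait m' + 2 * 3 ^ m')%N else 0%N.
Fixpoint drift m (l : 'I_d) := if m is m'.+1 then (drift m' l + 2 * side_len m' l)%N else 0%N.

Lemma box_step_drift m e q c S D e' q' c' S' l : box_step m e q c S D e' q' c' S' ->
  `|e' ord0 l - e ord0 l| <= (side_len m l)%:Z.
Proof.
move=> [[-> _] _ _ _ _]; rewrite nbrE cell_atE.
have := side_len_gt0 m l; set L := side_len m l => L0.
by case: (eqVneq l D) => [->|_]; case: (q _) => /=; lia.
Qed.

Lemma start_traversal m s : isSome (run peano s (wait m + 3 ^ m)) ->
  exists i e q c S, [/\ (i <= wait m)%N, run peano s i = Some (e, q), traversal m e q c S &
    forall l, `|e ord0 l - s.1 ord0 l| <= (drift m l)%:Z].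
Proof.
elim: m => [|m IH] def.
  case: s def => e q def; have [[e1 q1] E1] := run_some (leqnn _) def.
  have [ge _] := peanoP (E1 : peano (e, q) = _).
  exists 0%N, e, q, (cell_cert e), (fun l t => face_cert l t e); split=> // [|l].
    exact: traversal0.
  by rewrite subrr.
have [|i [e [q [c [S [iw runi T dr]]]]]] := IH.
  by apply: run_le def; rewrite /= expnS; lia.
set al : 'I_d := inZp m.
have defe j : (i + j <= wait m + 5 * 3 ^ m)%N -> isSome (run peano (e, q) j).
  by move=> ij; rewrite -(runD _ runi); apply: run_le def; rewrite /= expnS; lia.
(* A box whose position is the first one for its heading begins a row, which the
   path then traverses. *)
suff [j [e1 [q1 [c1 [S1 [j2 runj T1 st d1]]]]]] : exists j e1 q1 c1 S1,
   [/\ (j <= 2 * 3 ^ m)%N, run peano (e, q) j = Some (e1, q1), traversal m e1 q1 c1 S1,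
       cdig c1 al = last_digit (~~ q1 al) &
       forall l, `|e1 ord0 l - e ord0 l| <= (2 * side_len m l)%:Z].
  have runij : run peano s (i + j) = Some (e1, q1) by rewrite (runD _ runi).
  have [|c2 [S2 [T2 _]]] := triple (@next_traversal_all m) T1 st.
    rewrite -(runD _ runij); apply: run_le def; rewrite /= expnS; lia.
  exists (i + j)%N, e1, q1, c2, S2; split=> //=; first by lia.
  by move=> l; have := d1 l; have := dr l; lia.
have N1 := @next_traversal_all m _ _ _ _ T (defe _ _).
have [|D [e1 [q1 [c1 [S1 [run1 T1 st1]]]]]] := N1; first by lia.
have V0 := traversal_valid T; have V1 := traversal_valid T1.
have [[ee1 qq1] d01 _ _ _] := st1.
have after_end : cdig c al = last_digit (q al) -> cdig c1 al = last_digit (~~ q1 al).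
  move=> dc; rewrite d01 dc qq1; case: (eqVneq al D) => [->|ne].
    by rewrite flip_id last_digit_step.
  by rewrite flip_neq // negbK addr0.
have dr1 := box_step_drift _ st1.
case: (digitP (q al) (cdig c al)) => dc.
- by exists 0%N, e, q, c, S; split=> // l; rewrite subrr.
- have Dal : D = al by apply: (near_exit V0 V1 st1); rewrite dc mid_digit_neq.
  have q1al : q1 al = q al by rewrite qq1 Dal flip_id.
  have dc1 : cdig c1 al = last_digit (q1 al).
    by rewrite d01 dc Dal eqxx q1al mid_digit_step.
  have [|D2 [e2 [q2 [c2 [S2 [run2 T2 st2]]]]]] := @next_traversal_all m _ _ _ _ T1 _.
    by rewrite -(runD _ run1); apply: defe; lia.
  have [[ee2 qq2] d12 _ _ _] := st2.
  exists (2 * 3 ^ m)%N, e2, q2, c2, S2; split=> //.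
  + by rewrite mul2n -addnn (runD _ run1).
  + rewrite d12 dc1 qq2; case: (eqVneq al D2) => [->|ne].
      by rewrite flip_id last_digit_step.
    by rewrite flip_neq // negbK addr0.
  + by move=> l; have := box_step_drift l st2; have := dr1 l; lia.
- exists (3 ^ m)%N, e1, q1, c1, S1; split=> //; first by lia.
    exact: after_end.
  by move=> l; have := dr1 l; lia.
Qed.

End Config.
End Peano.

Lemma dvdn_mod_pred b x : (b.+1 %| x.+1)%N -> (x %% b.+1 = b)%N.
Proof.
rewrite /dvdn -addn1 -modnDml addn1.
have := ltn_pmod x (isT : (0 < b.+1)%N).
rewrite leq_eqVlt => /orP[/eqP[->] //|lt].
by rewrite modn_small.
Qed.

Section Expo.
Variable d' : nat.
Local Notation d := (d'.+2).

(** The number of levels below m that are congruent to l modulo d, that is, of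
    triplings in direction l. *)
Definition expo (m : nat) (l : 'I_d) : nat := ((m + (d'.+1 - l)) %/ d)%N.

Lemma expo_dvd m (l : 'I_d) : (d %| (m + (d'.+1 - l)).+1)%N = (l == inZp m).
Proof.
have ld := ltn_ord l; have -> : ((m + (d'.+1 - l)).+1 = m + d - l)%N by lia.
rewrite -eqn_mod_dvd; last by lia.
by rewrite modnDr -val_eqE /= (modn_small ld) eq_sym.
Qed.

Lemma expo0 (l : 'I_d) : expo 0 l = 0%N.
Proof. by rewrite /expo add0n divn_small //; lia. Qed.

Lemma expoS m (l : 'I_d) : expo m.+1 l = ((l == inZp m) + expo m l)%N.
Proof. by rewrite /expo addSn divnS // expo_dvd. Qed.

Lemma expo_mul k (l : 'I_d) : expo (k * d) l = k.
Proof. by rewrite /expo divnMDl // divn_small ?addn0 //; lia. Qed.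

Lemma expo_le m (l : 'I_d) r : (expo m l <= r)%N = (m <= d * r + l)%N.
Proof.
have ld := ltn_ord l; rewrite /expo -ltnS ltn_divLR // mulSnr mulnC.
by apply/idP/idP; lia.
Qed.

Lemma side_lenE m (l : 'I_d) : side_len m l = (3 ^ expo m l)%N.
Proof.
elim: m => [|m IH]; first by rewrite expo0.
by rewrite expoS /= IH; case: ifP => _; rewrite ?expnS.
Qed.

(** Between two triplings in direction l the drift grows by twice the side at each
    of d levels, and a tripling of the side absorbs what has accumulated: the
    residue counts the levels since the last tripling. *)
Lemma drift_bound m (l : 'I_d) :
  (drift m l <= 3 ^ expo m l * (d + 2 * ((m + (d'.+1 - l)) %% d)))%N.
Proof.
elim: m => [|m IH] //.
rewrite /= side_lenE expoS addSn modnS expo_dvd.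
case: ifP => h.
  have e := dvdn_mod_pred (etrans (expo_dvd m l) h).
  by move: IH; rewrite e add1n expnS; nia.
rewrite add0n; move: IH; move: (drift m l) (3 ^ expo m l)%N ((m + (d'.+1 - l)) %% d)%N.
move=> x E j IH; have -> : ((d'.+1 + 2 * j.+1).+1 = (d + 2 * j) + 2)%N by lia.
by rewrite mulnDr leq_add // mulnC.
Qed.

Lemma drift_mul k (l : 'I_d) : (drift (k * d) l <= 3 * d * 3 ^ k)%N.
Proof.
apply: leq_trans (drift_bound _ _) _; rewrite expo_mul mulnC leq_pmul2r ?expn_gt0 //.
by have := ltn_pmod (k * d + (d'.+1 - l)) (isT : (0 < d)%N); lia.
Qed.

(** At level r d the boxes are cubes of side 3^r > r, and the drift is at most 3 d
    sides. One more side is for the extent of the box itself. *)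
Lemma peano_cover : exists K, forall r, exists N T, (r <= N)%N /\
  forall a (s : pos d * signs d), isSome (run (peano a) s T) ->
  exists f : {ffun 'I_d -> 'I_N} -> pos d, injective f /\
  forall k, (forall l, `|f k ord0 l - s.1 ord0 l| <= (K * N)%:Z) /\
    exists i q', (i <= T)%N /\ run (peano a) s i = Some (f k, q').
Proof.
exists (3 * d + 1)%N => r; set m := (r * d)%N.
exists (3 ^ r)%N, (wait m + 3 ^ m)%N; split; first exact: ltnW (ltn_expl _ _).
move=> a s /start_traversal[i [e [q [c [S [iw runi T dr]]]]]].
have lenr (l : 'I_d) : side_len m l = (3 ^ r)%N by rewrite side_lenE expo_mul.
exists (fun k : {ffun 'I_d -> 'I_(3 ^ r)} => cell_at e q (fun l => k l)); split.
  move=> k k' /rowP E; apply/ffunP => l; apply/val_inj.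
  by have := E l; rewrite !cell_atE; case: (q l) => /=; lia.
move=> k; split.
  move=> l; have := dr l; have := drift_mul r l; have := ltn_ord (k l).
  rewrite cell_atE -/m; move: (drift m l) (3 ^ r)%N (nat_of_ord (k l)) => x y kk.
  by case: (q l) => /=; lia.
have [|j [q' [ltj runj]]] := @traversal_cover _ _ _ _ _ _ _ (fun l => k l) T.
  by move=> l; rewrite lenr.
exists (i + j)%N, q'; split; first by lia.
by rewrite (runD _ runi).
Qed.

End Expo.

(** * Balanced ternary expansion of the integers *)
Section Digits.
(** Rounding n / 3 to the nearest integer groups the integers into the intervals
    {3M - 1, 3M, 3M + 1}, and iteration gives nested intervals of length 3^k. In
    contrast with the usual base 3, in which the wall between -1 and 0 separates
    intervals of all lengths, every wall has a finite rank here, because every n is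
    eventually rounded to 0, the middle position ([coarse0_ex]). *)
Definition rnd3 (n : int) : int := ((n + 1) %/ 3)%Z.
Definition coarse k n := iter k rnd3 n.
Definition dig3 (n : int) : 'Z_3 := (n + 1)%:~R.
Definition dig k n := dig3 (coarse k n).

Lemma int3_Z3 (M : int) : (3 * M)%:~R = 0 :> 'Z_3.
Proof. by rewrite intrM (_ : 3%:~R = 0) ?mul0r //; apply/val_inj. Qed.

Lemma rnd3P n : exists M r, [/\ (r < 3)%N, n + 1 = 3 * M + r%:Z, rnd3 n = M &
   dig3 n = r%:R].
Proof.
exists (rnd3 n), `|((n + 1) %% 3)%Z|%N; rewrite /rnd3 /dig3.
have h0 : 0 <= ((n + 1) %% 3)%Z by rewrite modz_ge0.
have h3 : ((n + 1) %% 3)%Z < 3 by rewrite ltz_pmod.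
split=> //; first by lia.
  by rewrite {1}(divz_eq (n + 1) 3); lia.
by rewrite {1}(divz_eq (n + 1) 3) intrD mulrC int3_Z3 add0r -{1}(gez0_abs h0).
Qed.

Lemma rnd3_step t n :
  rnd3 (n + zsgn t) = rnd3 n + (if dig3 n == last_digit t then zsgn t else 0).
Proof.
have [M [r [r3 nM -> ->]]] := rnd3P n; have [M' [r' [r3' nM' -> _]]] := rnd3P (n + zsgn t).
have : (r%:R == last_digit t :> 'Z_3) = (r == if t then 2 else 0)%N.
  by move: r r3 {nM} => [|[|[|//]]] _; case: t {nM'}.
move=> ->; case: t nM' => /= nM'; case: eqP => rr; lia.
Qed.

Lemma dsgnE t : dsgn t = (zsgn t)%:~R.
Proof. by case: t. Qed.

Lemma dig3_step t n : dig3 (n + zsgn t) = dig3 n + dsgn t.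
Proof. by rewrite /dig3 addrAC [LHS]intrD dsgnE. Qed.

Lemma coarseS k n : coarse k.+1 n = rnd3 (coarse k n). Proof. by []. Qed.

Lemma coarse0_ex n : exists k, coarse k n = 0.
Proof.
have [b] := ubnP `|n|%N; elim: b n => // b IH n lt.
case: (eqVneq n 0) => [->|n0]; first by exists 0%N.
have [|k hk] := IH (rnd3 n).
  by have [M [r [r3 nM -> _]]] := rnd3P n; lia.
by exists k.+1; rewrite /coarse iterSr.
Qed.

Lemma coarse0_stay k j n : coarse k n = 0 -> coarse (j + k) n = 0.
Proof. by move=> h; elim: j => // j IH; rewrite addSn coarseS IH. Qed.

Lemma rank_ex k t n : exists j, (k <= j)%N && (dig j n != last_digit t).
Proof.
have [i hi] := coarse0_ex n; exists (k + i)%N; rewrite leq_addr /=.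
by rewrite /dig coarse0_stay //; case: t.
Qed.

(** The interval of rank k around n ends on side t at a wall; the rank is the least
    j such that this wall is interior to the interval of rank j + 1. *)
Definition rank k t n := ex_minn (rank_ex k t n).

Lemma rank_ge k t n : (k <= rank k t n)%N.
Proof. by rewrite /rank; case: ex_minnP => j /andP[]. Qed.

Lemma rank_dig k t n : dig (rank k t n) n != last_digit t.
Proof. by rewrite /rank; case: ex_minnP => j /andP[]. Qed.

Lemma rank_lt k t n j : (k <= j)%N -> (j < rank k t n)%N -> dig j n = last_digit t.
Proof.
rewrite /rank; case: ex_minnP => i _ hmin kj ji; apply/eqP/negPn/negP => h.
by have := hmin j; rewrite kj h /= => /(_ isT); lia.
Qed.

Lemma rank_uniq k t n r : (k <= r)%N -> dig r n != last_digit t ->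
  (forall j, (k <= j < r)%N -> dig j n = last_digit t) -> rank k t n = r.
Proof.
move=> kr hr hj; apply/eqP; rewrite eqn_leq; apply/andP; split; rewrite leqNgt; apply/negP => lt.
  by move: hr; rewrite (rank_lt kr lt) eqxx.
by have := rank_dig k t n; rewrite hj ?eqxx // rank_ge.
Qed.

Lemma coarse_same k n n' : coarse k n = coarse k n' -> forall j, (k <= j)%N -> coarse j n = coarse j n'.
Proof. by move=> h j /subnK <-; elim: (j - k)%N => // i IH; rewrite addSn !coarseS IH. Qed.

Lemma rank_same k t n n' : coarse k n = coarse k n' -> rank k t n = rank k t n'.
Proof.
move=> h; apply: rank_uniq (rank_ge _ _ _) _ _.
  by rewrite /dig (coarse_same h) ?rank_dig ?rank_ge.
by move=> j /andP[kj jr]; rewrite /dig (coarse_same h) // -/(dig j n') (rank_lt kj jr).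
Qed.

Lemma rank_le k t n : (k <= rank 0 t n)%N -> rank k t n = rank 0 t n.
Proof.
move=> h; apply: rank_uniq => //; first exact: rank_dig.
by move=> j /andP[_ jr]; apply: rank_lt jr.
Qed.

Lemma coarse_cross t n k : (k <= rank 0 t n)%N -> coarse k (n + zsgn t) = coarse k n + zsgn t.
Proof.
elim: k => // k IH lt; rewrite coarseS IH; last exact: ltnW.
by rewrite rnd3_step -/(dig k n) (rank_lt _ lt) // eqxx.
Qed.

Lemma coarse_nocross t n k : (rank 0 t n < k)%N -> coarse k (n + zsgn t) = coarse k n.
Proof.
move=> lt; apply: (@coarse_same (rank 0 t n).+1) => //.
rewrite coarseS coarse_cross // rnd3_step -/(dig _ n) (negbTE (rank_dig _ _ _)) addr0.
by rewrite coarseS.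
Qed.

Lemma dig_cross t n k : (k <= rank 0 t n)%N -> dig k (n + zsgn t) = dig k n + dsgn t.
Proof. by move=> h; rewrite /dig coarse_cross // dig3_step. Qed.

Lemma rank_opp t n : rank 0 (~~ t) (n + zsgn t) = rank 0 t n.
Proof.
apply: rank_uniq => //.
  by rewrite dig_cross // -last_digit_step (inj_eq (addIr _)) rank_dig.
move=> j /andP[_ jr]; rewrite dig_cross; last exact: ltnW.
by rewrite (rank_lt _ jr) // last_digit_step.
Qed.

End Digits.

(** * Labels that are good everywhere *)
Section Model.
Variable d' : nat.
Local Notation d := (d'.+2).
Local Notation pos := (pos d).
Local Notation dir m := (@inZp d'.+1 m).

(** The wall on side (l, t) of the box of level m around z cuts a box of level one
    more than its height. Heights are congruent to the direction l modulo d, so that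
    walls in different directions are never of equal height, and comparing heights
    decides which of two crossing walls is lower. *)
Definition height (m : nat) (l : 'I_d) (t : bool) (z : pos) : nat :=
  (d * rank (expo m l) t (z ord0 l) + l)%N.

Definition model_digits (m : nat) (z : pos) : digits d' := [ffun l => dig (expo m l) (z ord0 l)].

(** The certificate of the box of level m around z, with all entries read off the
    ternary expansion of z. *)
Definition model_cert (m : nat) (z : pos) : cert d' :=
  (model_digits m z, dig (expo m (dir m)).+1 (z ord0 (dir m)),
   [ffun lt : 'I_d * bool => model_digits (height m lt.1 lt.2 z).+1 z],
   [ffun t : bool => model_digits (height m.+1 (dir m) t z).+1 z]).

Definition model (z : pos) : label d' :=
  (model_cert 0 z, [ffun l => model_cert (height 0 l false z).+1 z]).

Lemma cdig_model m z l : cdig (model_cert m z) l = dig (expo m l) (z ord0 l).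
Proof. by rewrite ffunE. Qed.
Lemma cnext_model m z : cnext (model_cert m z) = dig (expo m (dir m)).+1 (z ord0 (dir m)).
Proof. by []. Qed.
Lemma cside_model m z l t : cside (model_cert m z) l t = model_digits (height m l t z).+1 z.
Proof. by rewrite /cside ffunE. Qed.
Lemma cparent_model m z t : cparent (model_cert m z) t = model_digits (height m.+1 (dir m) t z).+1 z.
Proof. by rewrite /cparent ffunE. Qed.

Definition same_box m (z z' : pos) :=
  forall l, coarse (expo m l) (z ord0 l) = coarse (expo m l) (z' ord0 l).

Lemma expo_mono m m' (l : 'I_d) : (m <= m')%N -> (expo m l <= expo m' l)%N.
Proof. by move=> h; apply: leq_div2r; rewrite leq_add2r. Qed.

Lemma same_box_le m m' z z' : (m <= m')%N -> same_box m z z' -> same_box m' z z'.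
Proof. by move=> h s l; apply: coarse_same (s l) _ _; apply: expo_mono. Qed.

Lemma model_digits_same m z z' : same_box m z z' -> model_digits m z = model_digits m z'.
Proof. by move=> s; apply/ffunP => l; rewrite !ffunE /dig s. Qed.

Lemma height_same m l t z z' : same_box m z z' -> height m l t z = height m l t z'.
Proof. by move=> s; rewrite /height (rank_same _ (s l)). Qed.

Lemma height_ge m l t z : (m <= height m l t z)%N.
Proof. by rewrite /height -expo_le rank_ge. Qed.

Lemma model_cert_same m z z' : same_box m z z' -> model_cert m z = model_cert m z'.
Proof.
move=> s; have sX M : (m <= M)%N -> model_digits M z = model_digits M z'.
  by move=> mM; apply: model_digits_same; apply: same_box_le s.
have s1 := same_box_le (leqnSn m) s.
apply: cert_eq; first exact: model_digits_same.
- by rewrite !cnext_model /dig (coarse_same (s _)).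
- move=> l t; rewrite !cside_model -(height_same _ _ s) sX //.
  exact: leq_trans (height_ge _ _ _ _) (leqnSn _).
- move=> t; rewrite !cparent_model -(height_same _ _ s1) sX //.
  by apply: leq_trans (leqnSn _); apply: leq_trans (height_ge _ _ _ _).
Qed.

(** Crossing a wall does not lead out of the boxes of level above its height. *)
Lemma same_box_nbr m l t z : (height 0 l t z < m)%N -> same_box m z (nbr z l t).
Proof.
move=> h i; rewrite nbrE; case: eqP => [->|_]; last by rewrite addr0.
by rewrite coarse_nocross // ltnNge expo_le -ltnNge; move: h; rewrite /height expo0.
Qed.

Lemma face_cert_model l t z : face_cert model l t z = model_cert (height 0 l t z).+1 z.
Proof.
rewrite /face_cert /model; case: t; rewrite /= ffunE //.
have -> : height 0 l false (nbr z l true) = height 0 l true z.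
  by rewrite /height !expo0 nbrE eqxx (rank_opp true).
by apply/esym/model_cert_same/same_box_nbr.
Qed.

Lemma inZp_mul r (l : 'I_d) : inZp (d * r + l) = l.
Proof.
by apply/val_inj => /=; rewrite mulnC modnMDl modn_small //; exact: ltn_ord.
Qed.

Lemma mul_inZp m : (d * expo m (dir m) + (dir m) = m)%N.
Proof.
apply/eqP; rewrite eqn_leq -expo_le leqnn andbT leqNgt; apply/negP => lt.
have : (expo m.+1 (dir m) <= expo m (dir m))%N by rewrite expo_le.
by rewrite expoS eqxx; lia.
Qed.

(** In its first direction, a wall of the box of level m is an internal wall of the parent exactly when its
    height is m; otherwise the wall of the parent on the same side is the same
    wall. *)
Lemma compat_model m l t z : (m <= height 0 l t z)%N ->
  compat (dir m) l t (model_cert m z) (model_cert m (nbr z l t)) (model_cert (height 0 l t z).+1 z).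
Proof.
move=> mh; have er : (expo m l <= rank 0 t (z ord0 l))%N.
  by rewrite expo_le; move: mh; rewrite /height expo0.
have hm : height m l t z = height 0 l t z by rewrite /height (rank_le er) expo0.
split.
- move=> i; rewrite !cdig_model nbrE; case: eqP => [->|_]; last by rewrite !addr0.
  by rewrite dig_cross.
- by rewrite cside_model hm.
move=> lm; have ml := mul_inZp m; rewrite -lm in ml.
rewrite cdig_model cnext_model -lm; case: ifP => [nr|/negbFE/eqP fr].
  have re : rank 0 t (z ord0 l) = expo m l.
    apply/eqP; rewrite eqn_leq er andbT leqNgt; apply/negP => lt.
    by move: nr; rewrite (rank_lt _ lt) // eqxx.
  have h_m : height 0 l t z = m by rewrite /height expo0 re ml.
  rewrite h_m; split.
  + by move=> i il; rewrite !cdig_model expoS -lm (negbTE il) add0n.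
  + by rewrite cdig_model expoS -lm eqxx add1n.
  + by move=> u; rewrite cside_model cparent_model -lm.
  + move=> i u il; rewrite !cside_model.
    have -> : height m i u (nbr z l t) = height m i u z.
      by rewrite /height nbrE (negbTE il) addr0.
    apply/esym/model_digits_same/same_box_nbr; rewrite h_m ltnS; exact: height_ge.
have r1 : ((expo m l).+1 <= rank 0 t (z ord0 l))%N.
  rewrite ltn_neqAle er andbT; apply/eqP => e.
  by have := rank_dig 0 t (z ord0 l); rewrite -e fr eqxx.
split; last by rewrite cnext_model -lm nbrE eqxx dig_cross.
rewrite cparent_model cside_model -lm hm; congr (model_digits _.+1 z).
by rewrite /height expoS -lm eqxx add1n (rank_le r1) expo0.
Qed.

Lemma ordS_inZp m : inZp m.+1 = ordS (dir m) :> 'I_d.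
Proof. by apply/val_inj => /=; rewrite -addn1 -(addn1 (m %% _)) modnDml. Qed.

Lemma lower_model j s l t z : j != l -> (height 0 j s z < height 0 l t z)%N ->
  lower model j s l t z.
Proof.
move=> jl lt; rewrite /lower !face_cert_model.
have hl : height 0 l t (nbr z j s) = height 0 l t z.
  by rewrite /height nbrE eq_sym (negbTE jl) addr0.
have hj : height 0 j s (nbr z l t) = height 0 j s z.
  by rewrite /height nbrE (negbTE jl) addr0.
rewrite hl hj; split.
  apply: model_cert_same; apply: same_box_nbr; exact: leq_trans lt (leqnSn _).
have -> : ordS j = inZp (height 0 j s z).+1 by rewrite ordS_inZp /height inZp_mul.
exact: compat_model.
Qed.

Lemma height_neq j s l t z : j != l -> height 0 j s z != height 0 l t z.
Proof.
move=> jl; apply/eqP => e; move/eqP: jl; apply.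
have : inZp (height 0 j s z) = inZp (height 0 l t z) :> 'I_d by rewrite e.
by rewrite /height !inZp_mul.
Qed.

Lemma good_model z : good model z.
Proof.
split=> [l t|j s l t jl].
  by rewrite face_cert_model -(inZp0 d'); exact: compat_model.
have := height_neq s t z jl; rewrite neq_ltn => /orP[] h; [left|right].
  exact: lower_model.
by apply: lower_model => //; rewrite eq_sym.
Qed.

(** The lowest of the d walls towards which the path is headed is the exit. *)
Lemma peano_model s : isSome (peano model s).
Proof.
rewrite /peano /exit_dir; case: asboolP => [_|[]]; last exact: good_model.
case: pickP => // none.
case: (arg_minnP (fun l => height 0 l (s.2 l) s.1) (isT : xpredT (ord0 : 'I_d))) => D _ hD.
have /asboolP[] := none D => l lD; apply: lower_model; first by rewrite eq_sym.
rewrite ltn_neqAle hD // andbT; apply: height_neq; by rewrite eq_sym.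
Qed.

Lemma run_model s n : isSome (run (peano model) s n).
Proof.
elim: n => // n; rewrite runS; case: (run _ _ _) => // s' _; exact: peano_model.
Qed.

End Model.

(** * Locality and equivariance of the Peano path *)
Section PeanoAutomaton.
Variable d' : nat.
Local Notation d := (d'.+2).

Lemma exit_dir_ext (a a' : pos d -> label d') z z' q :
  cell_cert a z = cell_cert a' z' ->
  (forall l t, cell_cert a (nbr z l t) = cell_cert a' (nbr z' l t)) ->
  (forall l t, face_cert a l t z = face_cert a' l t z') ->
  (forall j s l t, face_cert a l t (nbr z j s) = face_cert a' l t (nbr z' j s)) ->
  exit_dir a z q = exit_dir a' z' q.
Proof.
move=> hc hc' hf hf'.
have hl j s l t : lower a j s l t z = lower a' j s l t z'.
  by rewrite /lower !hf !hf'.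
have hg : good a z = good a' z'.
  apply/propext; split=> -[g1 g2]; split=> [l t|j s l t jl].
  - by rewrite -hc -hc' -hf; exact: g1.
  - by rewrite -!hl; exact: g2.
  - by rewrite hc hc' hf; exact: g1.
  - by rewrite !hl; exact: g2.
rewrite /exit_dir hg; case: ifP => // _; apply: eq_pick => D /=.
by apply/asbool_equiv_eq; split=> h l lD; [rewrite -hl|rewrite hl]; exact: h.
Qed.

Lemma nbrD (z m : pos d) l t : nbr z l t + m = nbr (z + m) l t.
Proof. by rewrite /nbr addrAC. Qed.

Lemma peano_equi (a : pos d -> label d') m z q :
  peano (fun n => a (n + m)) (z, q) =
  omap (fun s => (s.1 - m, s.2)) (peano a (z + m, q)).
Proof.
have fcm l t w : face_cert (fun n => a (n + m)) l t w = face_cert a l t (w + m).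
  by rewrite /face_cert; case: t; rewrite ?nbrD.
rewrite /peano /= (@exit_dir_ext _ a z (z + m)).
- by case: (exit_dir _ _ _) => //= D; rewrite -nbrD addrK.
- by [].
- by move=> l t; rewrite /cell_cert nbrD.
- by move=> l t; exact: fcm.
- by move=> j s l t; rewrite fcm nbrD.
Qed.

(** The rules at z involve labels at distance at most two: edges compare the faces
    of neighbouring cells. *)
Lemma peano_local z q : exists B : seq (pos d), forall a a' : pos d -> label d',
  (forall w, w \in B -> a w = a' w) -> peano a (z, q) = peano a' (z, q).
Proof.
pose nb (w : pos d) := w :: [seq nbr w lt.1 lt.2 | lt <- enum {: 'I_d * bool}].
have nbw w : w \in nb w by exact: mem_head.
have nbm w l t : nbr w l t \in nb w.
  by rewrite inE; apply/orP; right; apply/mapP; exists (l, t); rewrite ?mem_enum.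
exists (flatten [seq nb w | w <- nb z]) => a a' h.
have h2 w v : w \in nb z -> v \in nb w -> a v = a' v.
  by move=> wz vw; apply: h; apply/flatten_mapP; exists w.
have hfc w l t : w \in nb z -> face_cert a l t w = face_cert a' l t w.
  by move=> wz; rewrite /face_cert; case: t; rewrite (h2 w).
rewrite /peano /= (@exit_dir_ext a a' z z) //.
- by rewrite /cell_cert (h2 z).
- by move=> l t; rewrite /cell_cert (h2 z).
- by move=> l t; exact: hfc.
- by move=> j s l t; exact: hfc.
Qed.

End PeanoAutomaton.

(** * Dimension one *)
Section Line.

Definition line_next (a : 'rV[int]_1 -> unit) (s : 'rV[int]_1 * unit) :
  option ('rV[int]_1 * unit) := Some (s.1 + const_mx 1, s.2).

Lemma run_line a s n : run (line_next a) s n = Some (s.1 + const_mx n%:Z, s.2).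
Proof.
elim: n => [|n IH].
  by rewrite /run /= (_ : const_mx 0 = 0) ?addr0 -?surjective_pairing //; apply/rowP => i; rewrite !mxE.
rewrite runS IH /= /line_next /= -addrA; congr (Some (_ + _, _)).
by apply/rowP => i; rewrite !mxE; lia.
Qed.

Lemma line_cover : covering line_next 1.
Proof.
move=> r; exists r, r; split=> // a s _.
exists (fun k : {ffun 'I_1 -> 'I_r} => s.1 + const_mx (k ord0 : nat)%:Z); split.
  move=> k k' /addrI/rowP/(_ ord0); rewrite !mxE => -[e].
  by apply/ffunP => i; rewrite (ord1 i); apply/val_inj.
move=> k; have := ltn_ord (k ord0) => kr; split.
  by move=> l; rewrite !mxE addrAC subrr add0r mul1n; lia.
by exists (k ord0), s.2; rewrite run_line; split=> //; exact: ltnW.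
Qed.

End Line.

Local Open Scope ereal_scope.

Theorem theorem3p4 (R : realType) (d : nat) (hd : (1 <= d)%N) :
  exists (S : finType) (T : full_shift d S -> full_shift d S),
    [/\ cellular_automaton T,
        set_surj setT setT T &
        0 < topological_entropy R T < +oo].
Proof.
case: d hd => [//|[_|d' _]].
  apply: (@route_entropy R 1 1 unit unit line_next (fun=> tt) (0%R, tt)) => //.
  - by move=> a m z q; rewrite /line_next /= addrAC addrK.
  - by exists [::].
  - exact: line_cover.
  - by move=> n; rewrite run_line.
have [K cov] := peano_cover d'.
apply: (@route_entropy R _ K (label d') (signs d'.+2) (@peano d') (@model d')
  (0%R, [ffun=> true])) => //.
- exact: peano_equi.
- exact: peano_local.
- exact: run_model.
Qed.
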